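(* Let $\mathbb M'=[0,\infty)$. Consider a score function of the form $\xi(\Psi)=\sum_i H(X_i,M_i',S_{X_i}\Phi)$ for a measurable function $H$ on $\mathbb R^d\times\mathbb M'\times\mathbb N^0_{\mathbb M}$ with values either in $[0,\infty)\cup\{-\infty\}$ or in $[-\infty,0]$, and let $f(m',\varphi)=\sum_{x\in\varphi}H(-x,m',\varphi)$ for $m'\ge0$, $\varphi\in\mathbb N^0_{\mathbb M}$. Assume that $f$ is continuous in $m'$ for $\mathbb P^0$-almost all realizations $\varphi$ of the base process $\Phi$, and that $-\infty<\gamma_{\xi,\mathsf{opt}}<\infty$. Then the marking given by $M_i':=\arg\max_{m'\ge0}f(m',S_{X_i}\Phi)$ is the (distributionally) unique intensity-optimal marking if and only if the function $m'\mapsto f(m',\Phi)$ has a unique maximum in $m'$ for $\mathbb P^0$-almost all realizations of the base process $\Phi$.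
   Context: $\mathbb M$ is a locally compact, second countable, Hausdorff space. For such a space $\mathbb K$, $\mathbb N_{\mathbb K}$ is the set of locally finite subsets of $\mathbb R^d\times\mathbb K$ containing at most one element of each $\{x\}\times\mathbb K$, with the evaluation $\sigma$-algebra; $\mathbb N^0_{\mathbb M}$ and $\mathbb N^0_{\mathbb M\times\mathbb M'}$ are the subsets of configurations having a point at the origin $o$. $S_y$ shifts atoms $(x,m)\mapsto(x-y,m)$, resp. $(x,m,m')\mapsto(x-y,m,m')$; $\pi:\mathbb N_{\mathbb M\times\mathbb M'}\to\mathbb N_{\mathbb M}$ forgets the $\mathbb M'$-marks; $x\in\varphi$ also denotes the location of an atom of $\varphi$. $\Phi=\{(X_i,M_i)\}_i$ is a given stationary random element of $\mathbb N_{\mathbb M}$ with intensity $\lambda=\mathbb E[\Phi([0,1]^d\times\mathbb M)]\in(0,\infty)$. $\mathcal T(\Phi)$ is the set of (laws of) stationary markings of $\Phi$: stationary random elements $\Psi=\{(X_i,M_i,M_i')\}_i$ of $\mathbb N_{\mathbb M\times\mathbb M'}$, possibly on a new probability space, with $\pi(\Psi)$ distributed as $\Phi$ (one then re-defines $\Phi:=\pi(\Psi)$). $\mathbb P^0,\mathbb E^0$ denote Palm probability and expectation with respect to the points $X_i$; under it there is a point $X_0=o$. The score $\xi$ is evaluated on $\mathbb N^0_{\mathbb M\times\mathbb M'}$, the $\xi$-intensity is $\gamma_\xi(\Psi)=\mathbb E[\sum_{X_i\in\Psi\cap[0,1]^d}\xi(S_{X_i}\Psi)]=\lambda\mathbb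 E^0[\xi(\Psi)]$, $\gamma_{\xi,\mathsf{opt}}=\sup_{\Psi\in\mathcal T(\Phi)}\gamma_\xi(\Psi)$, and $\Psi\in\mathcal T(\Phi)$ is intensity-optimal if $\gamma_\xi(\Psi)=\gamma_{\xi,\mathsf{opt}}$. Distributional uniqueness means that any two intensity-optimal markings have the same law on $\mathbb N_{\mathbb M\times\mathbb M'}$. When $\arg\max_{m'\ge0}f(m',\varphi)$ contains several points, the marking is understood with the smallest element. The series defining $\xi$ and $f$ take the value $-\infty$ if at least one term is $-\infty$; likewise expectations take the value $-\infty$ if a quantity with values in $[0,\infty]\cup\{-\infty\}$ equals $-\infty$ with positive probability. *)

(* Defs.v *)
From HB Require Import structures.
From mathcomp Require Import all_boot all_order all_algebra.
From mathcomp Require Import all_classical all_reals all_analysis.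
From mathcomp Require Import measurable_realfun.

Set Implicit Arguments.
Unset Strict Implicit.
Unset Printing Implicit Defensive.
Import Order.TTheory GRing.Theory Num.Theory.
Import numFieldNormedType.Exports.

Local Open Scope classical_set_scope.
Local Open Scope ring_scope.

Notation borel T := (g_sigma_algebraType (@open T)).

(* The mark space [0, +oo[ with the topology induced by R. *)
Definition halfline (R : realType) : Type := set_type [set x : R | 0 <= x].

Section halfline.
Variable R : realType.

HB.instance Definition _ := Topological.copy (halfline R)
  (set_type [set x : R | 0 <= x]).

Fact halfline_zero : (0 : R) \in [set x : R | 0 <= x].
Proof. by rewrite inE /=. Qed.

HB.instance Definition _ := isPointed.Build (halfline R)
  (exist _ (0 : R) halfline_zero).

End halfline.

(* Point configurations in R^d x K: locally finite sets with at most one mark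
   per location.  Local finiteness means finitely many points over each bounded
   set of locations, whatever their marks: finiteness on compact subsets of
   R^d x K only would not be preserved when a non-compact mark component is
   forgotten. *)
Record config (R : realType) (d : nat) (K : topologicalType) := Config {
  atoms : set ('rV[R]_d * K);
  atoms_fin : forall r : R, finite_set (atoms `&` [set z | `|z.1| <= r]);
  atoms_inj : forall x k k', atoms (x, k) -> atoms (x, k') -> k = k' }.

Section config_measurable.
Variables (R : realType) (d : nat) (K : topologicalType).

HB.instance Definition _ := gen_eqMixin (config R d K).
HB.instance Definition _ := gen_choiceMixin (config R d K).

Fact config0_fin (r : R) :
  finite_set ((set0 : set ('rV[R]_d * K)) `&` [set z | `|z.1| <= r]).
Proof. by rewrite set0I. Qed.

Fact config0_inj x k k' : (set0 : set ('rV[R]_d * K)) (x, k) ->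
  (set0 : set ('rV[R]_d * K)) (x, k') -> k = k'.
Proof. by []. Qed.

HB.instance Definition _ := isPointed.Build (config R d K)
  (Config config0_fin config0_inj).

(* The evaluations phi |-> phi(B), B Borel, generate the sigma-algebra. *)
Definition evaluation (B : set ('rV[R]_d * K)) (phi : config R d K) : \bar R :=
  counting (atoms phi `&` B).

Definition evaluation_system : set (set (config R d K)) :=
  \bigcup_(B in <<s @open ('rV[R]_d * K)%type >>)
    preimage_set_system setT (evaluation B) measurable.

Definition configs : Type := g_sigma_algebraType evaluation_system.

HB.instance Definition _ := Measurable.copy configs
  (g_sigma_algebraType evaluation_system).

End config_measurable.

Arguments configs : clear implicits.

Section shift.
Variables (R : realType) (d : nat) (K : topologicalType).
Variables (y : 'rV[R]_d) (phi : configs R d K).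

Let shifted : set ('rV[R]_d * K) :=
  [set (z.1 - y, z.2) | z in atoms phi].

Fact shift_fin (r : R) : finite_set (shifted `&` [set z | `|z.1| <= r]).
Proof.
apply: (@sub_finite_set _ _ ((fun z : 'rV[R]_d * K => (z.1 - y, z.2)) @`
  (atoms phi `&` [set z | `|z.1| <= r + `|y|]))).
  move=> _ [[z phiz <-]] /= zr; exists z => //; split=> //=.
  by rewrite -[z.1](subrK y) (le_trans (ler_normD _ _))// lerD2r.
exact/finite_image/atoms_fin.
Qed.

Fact shift_inj x k k' : shifted (x, k) -> shifted (x, k') -> k = k'.
Proof.
move=> [[a l] /= phia [<- <-]] [[b l'] /= phib [/addIr eab <-]].
by move: phib; rewrite eab; exact: atoms_inj.
Qed.

Definition shift : configs R d K := Config shift_fin shift_inj.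

End shift.

Section project.
Variables (R : realType) (d : nat) (M M' : topologicalType).
Variable psi : configs R d (M * M')%type.

Let forget : set ('rV[R]_d * M) :=
  [set (z.1, z.2.1) | z in atoms psi].

Fact project_fin (r : R) : finite_set (forget `&` [set z | `|z.1| <= r]).
Proof.
apply: (@sub_finite_set _ _ ((fun z : 'rV[R]_d * (M * M') => (z.1, z.2.1)) @`
  (atoms psi `&` [set z | `|z.1| <= r]))).
  by move=> _ [[z psiz <-]] /= zr; exists z.
exact/finite_image/atoms_fin.
Qed.

Fact project_inj x k k' : forget (x, k) -> forget (x, k') -> k = k'.
Proof.
move=> [[a l] /= psia [<- <-]] [[b l'] /= psib [eab <-]].
by move: psib; rewrite eab => psib; rewrite (atoms_inj psia psib).
Qed.

Definition project : configs R d M := Config project_fin project_inj.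

End project.

Section palm.
Variables (R : realType) (d : nat) (K : topologicalType).
Local Open Scope ereal_scope.

Definition unit_cube : set 'rV[R]_d :=
  [set x | forall i, (0 <= x ord0 i <= 1)%R].

Definition with_origin : set (configs R d K) :=
  [set phi | exists k, atoms phi (0%R, k)].

Definition stationary (L : probability (configs R d K) R) :=
  forall (y : 'rV[R]_d) (A : set (configs R d K)), measurable A ->
    L (shift y @^-1` A) = L A.

Definition intensity (L : probability (configs R d K) R) : \bar R :=
  \int[L]_phi evaluation (unit_cube `*` setT) phi.

Definition palm (L : probability (configs R d K) R)
    (A : set (configs R d K)) : \bar R :=
  (fine (intensity L))^-1%:E *
  \int[L]_phi evaluation [set z | unit_cube z.1 /\ A (shift z.1 phi)] phi.

(* Sum of a family with values in [0, +oo] `|` {-oo}, or in [-oo, 0]: since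
   +oo - +oo = -oo in \bar R, it is -oo as soon as one term is -oo.  The
   library integral \int f = \int f^\+ - \int f^\- has the same convention. *)
Definition series_over (T : choiceType) (S : set T) (a : T -> \bar R) : \bar R :=
  \esum_(z in S) a^\+ z - \esum_(z in S) a^\- z.

Definition score_intensity (xi : configs R d K -> \bar R)
    (L : probability (configs R d K) R) : \bar R :=
  \int[L]_psi series_over (atoms psi `&` [set z | unit_cube z.1])
    (fun z => xi (shift z.1 psi)).

End palm.

Section markings.
Variables (R : realType) (d : nat) (M M' : topologicalType).
Local Open Scope ereal_scope.

Definition is_marking (L : probability (configs R d M) R)
    (Q : probability (configs R d (M * M')%type) R) :=
  stationary Q /\
  forall A : set (configs R d M), measurable A ->
    Q (@project R d M M' @^-1` A) = L A.

Definition optimal_intensity (xi : configs R d (M * M')%type -> \bar R)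
    (L : probability (configs R d M) R) : \bar R :=
  ereal_sup [set score_intensity xi Q | Q in is_marking L].

Definition intensity_optimal (xi : configs R d (M * M')%type -> \bar R)
    (L : probability (configs R d M) R)
    (Q : probability (configs R d (M * M')%type) R) :=
  is_marking L Q /\ score_intensity xi Q = optimal_intensity xi L.

Definition mark_score (H : 'rV[R]_d -> M' -> configs R d M -> \bar R)
    (psi : configs R d (M * M')%type) : \bar R :=
  series_over (atoms psi)
    (fun z => H z.1 z.2.2 (shift z.1 (project psi))).

Definition mark_gain (H : 'rV[R]_d -> M' -> configs R d M -> \bar R)
    (m : M') (phi : configs R d M) : \bar R :=
  series_over (atoms phi) (fun z => H (- z.1)%R m phi).

End markings.

Section argmax.
Variables (R : realType) (d : nat) (M : topologicalType).
Local Open Scope ereal_scope.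
Let M' := halfline R.

Definition is_argmax (g : M' -> \bar R) (m : M') := forall m', g m' <= g m.

Definition least_argmax (g : M' -> \bar R) (m : M') :=
  is_argmax g m /\ forall m', is_argmax g m' -> (val m <= val m')%R.

(* Q is the law of a marked process in which, almost surely, the new mark of
   each X_i is the least maximiser of f(., S_{X_i} Phi); in particular these
   maximisers exist.  Given the law of the base process, this determines Q. *)
Definition argmax_marking (H : 'rV[R]_d -> M' -> configs R d M -> \bar R)
    (Q : probability (configs R d (M * M')%type) R) :=
  {ae Q, forall psi : configs R d (M * M')%type,
    forall z, atoms psi z ->
      least_argmax (fun m => mark_gain H m (shift z.1 (project psi))) z.2.2}.

End argmax.

(* Main.v *)
From HB Require Import structures.
From mathcomp Require Import all_boot all_order all_algebra finmap.
From mathcomp Require Import all_classical all_reals all_analysis.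
From mathcomp Require Import measurable_realfun lra.
Import Order.TTheory GRing.Theory Num.Theory.
Import numFieldNormedType.Exports.
Require Import Defs.

(** Why the theorem holds.  Write [f m phi] for [mark_gain H m phi], let [F phi]
be its supremum over [m], and let [L] be the law of the base process.

The score of a point [X_i] is a sum of terms [H (X_j - X_i) M'_j (S_{X_j} Phi)],
which depend on [M'_j] and on the base process seen from [X_j].  Let [X_j]
receive these terms instead of [X_i]: by the mass transport principle for
stationary processes, the score intensity of a marking is the expected sum of
[f M'_j (S_{X_j} Phi)] over the points [X_j] of the unit cube
([score_intensity_gain]).  So the marks can be optimised separately, and
no marking exceeds the number [V] obtained from this sum with [F] in place of
[f M'_j].

If [f _ phi] has a unique maximiser for Palm-almost all [phi], then marking
every point by the maximiser seen from it gives a stationary marking of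
intensity [V].  An optimal marking also has intensity [V], which is
finite; as [f <= F], almost surely [f M'_j (S_{X_j} Phi) = F (S_{X_j} Phi)] at the
points of the unit cube, and by stationarity at all points.  Its marks are
therefore a fixed function of the base process, which determines its law
([unique_argmax_unique_optimal]).

Conversely, suppose that the marking by least maximisers exists and is the only
optimal one.  For each rational [q >= 0], let [m_q] be the least of the
maximisers that are at least [q], or the least maximiser if there are none.  Marking by
[m_q] is again optimal, so it has the law of the marking by least maximisers,
and [m_q] is almost surely the least maximiser as seen from all points.  If
this holds for all [q], there are no two distinct maximisers, as a rational
between them would give an [m_q] that is not the least one
([unique_optimal_unique_argmax]).

Three tools support this.  A property holds Palm-almost surely if and only if
almost surely it is seen from all points of the process ([palm_aeP]), so that
Palm expectations never appear in the argument.  A sum over the atoms of a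
random configuration is measurable ([measurable_esum_atoms]), since the counting
measure of the atoms is a kernel; with it come the measurability of shifts,
projections and markings.  Finally, as the values of [H] are nonnegative or
[-oo], or all nonpositive, the positive and negative parts of the sums and integrals
can be treated separately: the convention for [+oo - +oo] is only used when the
result is [-oo] anyway ([subtractable]). *)

Set Implicit Arguments.
Unset Strict Implicit.
Unset Printing Implicit Defensive.

Local Open Scope classical_set_scope.
Local Open Scope ring_scope.

(** * Second countable spaces and their Borel sets *)

HB.instance Definition _ (A B : ptopologicalType) := Pointed.on (A * B)%type.

Lemma countable_image (T U : Type) (f : T -> U) (A : set T) :
  countable A -> countable (f @` A).
Proof. by move=> cA; exact: sub_countable (card_image_le _ _) cA. Qed.

Lemma second_countable_prod (A B : topologicalType) :
  @second_countable A -> @second_countable B -> @second_countable (A * B)%type.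
Proof.
move=> [bA cA [oA nA]] [bB cB [oB nB]].
exists [set UV.1 `*` UV.2 | UV in bA `*` bB].
  by apply: countable_image; exact: countableX.
split=> [_ [[U V] [/= bU bV] <-]|[x y] W].
  rewrite openE => -[x y] [/= Ux Vy]; exists (U, V) => //=.
  by split; apply: open_nbhs_nbhs; split => //; [exact: oA|exact: oB].
move=> [[U V] [/= nU nV] UVW].
have [U' [bU' U'x] U'U] := nA x U nU.
have [V' [bV' V'y] V'V] := nB y V nV.
exists (U' `*` V').
  by split => //; exists (U', V').
by move=> [a b] [/= /U'U Ua /V'V Vb]; exact: UVW.
Qed.

(** The balls of radius [1 / (n + 1)] around the points of the dense set form a base;
interiors are taken since balls of a pseudometric space need not be open. *)
Lemma second_countable_dense (R : realType) (T : pseudoMetricType R)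
  (D : set T) : countable D -> dense D -> @second_countable T.
Proof.
move=> cD dD.
exists [set (ball q.1 q.2.+1%:R^-1)° | q in D `*` [set: nat]].
  by apply: countable_image; apply: countableX.
split=> [_ [[q n] _ <-]|x V /nbhs_ballP[e /= e0 eV]]; first exact: open_interior.
have [//|n] := @ltr_add_invr R 0%R (e / 2) _; first by rewrite divr_gt0.
rewrite add0r => ne.
have n0 : (0 : R) < n.+1%:R^-1 by [].
have n2 : (0 : R) < n.+1%:R^-1 / 2 by rewrite divr_gt0.
have [|q [qB Dq]] := dD (ball x (n.+1%:R^-1 / 2))° _ (@open_interior _ _).
  by exists x; exact: nbhsx_ballx.
have xq : ball x (n.+1%:R^-1 / 2) q by exact: interior_subset qB.
exists (ball q n.+1%:R^-1)°; last first.
  move=> y /interior_subset qy; apply: eV; rewrite [e]splitr.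
  apply: (@ball_triangle _ _ q); last exact: le_ball (ltW ne) _ qy.
  by apply: le_ball xq; rewrite (le_trans _ (ltW ne))// ler_pdivrMr// ler_peMr// ?ler1n// ltW.
split; first by exists (q, n).
rewrite /interior -nbhs_ballE /=; exists (n.+1%:R^-1 / 2) => //= y xy.
by rewrite [n.+1%:R^-1]splitr; apply: (@ball_triangle _ _ x) => //; exact: ball_sym.
Qed.

(** Row vectors with rational entries are dense, balls being those of the sup
norm. *)
Lemma second_countable_rV (R : realType) (d : nat) :
  @second_countable 'rV[R]_d.
Proof.
apply: (@second_countable_dense R _ [set map_mx (@ratr R) q | q in [set: 'rV[rat]_d]]).
  exact/countable_image/countableP.
move=> O [x Ox] oO.
have /nbhs_ballP[e /= e0 eO] : nbhs x O by exact: open_nbhs_nbhs.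
have h j : exists q : rat, ball (x ord0 j) e (ratr q).
  have [|y [xy [q _ qy]]] := @dense_rat R (ball (x ord0 j) e)° _ (@open_interior _ _).
    by exists (x ord0 j); exact: nbhsx_ballx.
  by exists q; rewrite qy; exact: interior_subset xy.
pose q : 'rV[rat]_d := \row_j projT1 (cid (h j)).
exists (map_mx (@ratr R) q); split; last by exists q.
apply: eO; split => // i j; rewrite !mxE [i]ord1.
exact: projT2 (cid (h j)).
Qed.

Lemma second_countable_real (R : realType) : @second_countable R.
Proof.
apply: (@second_countable_dense R R (@ratr R @` setT)); last exact: dense_rat.
exact/countable_image/countableP.
Qed.

Lemma second_countable_halfline (R : realType) : @second_countable (halfline R).
Proof.
have [B cB [oB nB]] := second_countable_real R.
exists [set val @^-1` U | U in B].
  exact: countable_image.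
split=> [_ [U BU <-]|x V]; first by exists U => //; exact: oB.
rewrite nbhsE => -[W [[W' oW' <-] /= W'x] W'V].
have [U [BU Ux] UW] := nB (val x) W' (open_nbhs_nbhs (conj oW' W'x)).
exists (val @^-1` U); first by split => //; exists U.
by move=> y /= /UW W'y; exact: W'V.
Qed.

Section borel.

Lemma countable_bigcup_measurable d (X : measurableType d) (I : Type)
    (S : set I) (F : I -> set X) : countable S ->
  (forall i, S i -> measurable (F i)) -> measurable (\bigcup_(i in S) F i).
Proof.
elim/Ppointed: I => I in S F *; first by rewrite emptyE bigcup_set0.
move=> /countable_injP[f injf] mF.
rewrite (_ : \bigcup_(i in S) F i = \bigcup_(n in f @` S) F ('pinv_(fun=> point) S f n)).
  apply: bigcup_measurable => n [i Si <-]; apply: mF.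
  by rewrite pinvKV ?inE.
rewrite bigcup_image; apply: eq_bigcupr => i Si.
by rewrite pinvKV ?inE.
Qed.

Lemma borel_open (T : ptopologicalType) (U : set T) : open U ->
  measurable (U : set (borel T)).
Proof. by move=> oU; apply: sub_sigma_algebra. Qed.

Lemma measurable_fun_borel d (X : measurableType d) (T : ptopologicalType)
    (f : X -> T) :
  (forall U, open U -> measurable (f @^-1` U)) ->
  @measurable_fun _ _ X (borel T) setT f.
Proof.
move=> h; apply: (@measurability _ _ X (borel T) setT f (@open T)) => //.
by move=> _ [U oU <-]; rewrite setTI; exact: h.
Qed.

Lemma continuous_borel (A B : ptopologicalType) (f : A -> B) : continuous f ->
  @measurable_fun _ _ (borel A) (borel B) setT f.
Proof.
move=> /continuousP cf; apply: measurable_fun_borel => U /cf oU.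
exact: borel_open.
Qed.

(** This fails for the Borel sigma-algebra of a product in general: second
countability makes every open set a countable union of open rectangles. *)
Lemma measurable_pair_borel d (X : measurableType d) (A B : ptopologicalType)
    (f : X -> A) (g : X -> B) : @second_countable A -> @second_countable B ->
  @measurable_fun _ _ X (borel A) setT f ->
  @measurable_fun _ _ X (borel B) setT g ->
  @measurable_fun _ _ X (borel (A * B)%type) setT (fun x => (f x, g x)).
Proof.
move=> [bA cA [oA nA]] [bB cB [oB nB]] mf mg.
apply: (@measurable_fun_borel _ X (A * B)%type) => W oW.
pose S := [set UV : set A * set B | [/\ bA UV.1, bB UV.2 & UV.1 `*` UV.2 `<=` W]].
have cS : countable S.
  apply: (@sub_countable _ _ _ (bA `*` bB)); last exact: countableX.
  by apply: subset_card_le => UV [].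
have -> : (fun x => (f x, g x)) @^-1` W =
    \bigcup_(UV in S) ((f @^-1` UV.1) `&` (g @^-1` UV.2)).
  apply/seteqP; split=> [x /= Wfg|x [[U V] [/= _ _ UVW] [/= ? ?]]]; last exact: UVW.
  have : nbhs (f x, g x) W by exact: open_nbhs_nbhs.
  move=> [[U V] [/= nU nV] UVW].
  have [U' [bU' U'x] U'U] := nA _ U nU.
  have [V' [bV' V'y] V'V] := nB _ V nV.
  exists (U', V') => //; split => // -[a b] [/= /U'U ? /V'V ?]; exact: UVW.
apply: countable_bigcup_measurable => // -[U V] [/= bU bV _]; apply: measurableI.
  by rewrite -[X in measurable X]setTI; apply: mf => //; apply: borel_open; exact: oA.
by rewrite -[X in measurable X]setTI; apply: mg => //; apply: borel_open; exact: oB.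
Qed.

End borel.

(** * Sums over the atoms of a random configuration *)

Local Open Scope ereal_scope.

Section esum_complements.
Context {R : realType}.

Lemma counting_esum (T : choiceType) (S : set T) :
  @counting T R S = \esum_(z in S) 1.
Proof.
have [fS|iS] := pselect (finite_set S).
  rewrite /counting asboolT// esum_fset// fsbig_finite//=.
  by rewrite sumEFin big_const_seq count_predT iter_addr addr0.
rewrite /counting asboolF//; apply/esym/eqyP => A A0.
have [B BS cB] := @infinite_set_fset _ S (Num.truncn A).+1 iS.
apply: esum_ge; exists [set` B]; first by split.
rewrite fsbig_finite//= set_fsetK sumEFin big_const_seq count_predT iter_addr addr0.
rewrite lee_fin (le_trans (ltW (Num.Theory.truncnS_gt _)))//.
by rewrite ler_nat.
Qed.

Lemma exchange_esum (T U : choiceType) (A : set T) (B : set U)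
    (a : T -> U -> \bar R) : (forall i j, 0 <= a i j) ->
  \esum_(i in A) \esum_(j in B) a i j = \esum_(j in B) \esum_(i in A) a i j.
Proof.
move=> a0; rewrite !esum_esum//.
rewrite (reindex_esum (B `*`` (fun=> A)) _ (fun x => (x.2, x.1)))//; split=> //=.
- by move=> [i j] [].
- by move=> [i1 i2] [j1 j2] /= _ _ [] -> ->.
- by move=> [i1 i2] [Pi1 Qi2] /=; exists (i2, i1).
Qed.

Lemma esum_eq0P (T : choiceType) (A : set T) (a : T -> \bar R) :
  (forall i, A i -> 0 <= a i) ->
  \esum_(i in A) a i = 0 <-> forall i, A i -> a i = 0.
Proof.
move=> a0; split=> [s0 i Ai|]; last exact: esum1.
apply/eqP; rewrite eq_le a0// andbT -s0; apply: esum_ge.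
by exists [set i]; rewrite ?fsbig_set1//; split => // _ ->.
Qed.

Lemma le_esum_term (T : choiceType) (A : set T) (a : T -> \bar R) i :
  A i -> 0 <= a i -> a i <= \esum_(i in A) a i.
Proof.
move=> Ai a0; apply: esum_ge.
by exists [set i]; rewrite ?fsbig_set1//; split => // _ ->.
Qed.

End esum_complements.

Section atom_measure.
Context {R : realType} {d : nat} {K : ptopologicalType}.
Local Notation Z := ('rV[R]_d * K)%type.
Implicit Types (phi : configs R d K) (B : set Z).

(** There are finitely many atoms over each of the countably many balls centred at
the origin. *)
Lemma countable_atoms phi : countable (atoms phi).
Proof.
have -> : atoms phi = \bigcup_n (atoms phi `&` [set z | (`|z.1| <= n%:R)%R]).
  apply/seteqP; split=> [z pz|z [n _ []]//]; exists (Num.truncn `|z.1|).+1 => //.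
  by split => //=; exact/ltW/Num.Theory.truncnS_gt.
by apply: bigcup_countable => // n _; exact/finite_set_countable/atoms_fin.
Qed.

Lemma evaluation_esum B phi : evaluation B phi = \esum_(z in atoms phi) (\1_B z)%:E.
Proof.
rewrite /evaluation counting_esum esum_mkcondr; apply: eq_esum => z _.
by rewrite indicE; case: ifPn.
Qed.

Definition atom_measure phi : set (borel Z) -> \bar R := fun B => evaluation B phi.

Let atom_measure0 phi : atom_measure phi set0 = 0.
Proof. by rewrite /atom_measure evaluation_esum esum1// => z _; rewrite indic0. Qed.

Let atom_measure_ge0 phi B : 0 <= atom_measure phi B.
Proof. by rewrite /atom_measure evaluation_esum esum_ge0// => z _; rewrite lee_fin. Qed.

Let atom_measure_sigma_additive phi : semi_sigma_additive (atom_measure phi).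
Proof.
move=> F mF tF mUF; rewrite [X in _ --> X](_ : _ = \sum_(i <oo) atom_measure phi (F i)).
  by apply: is_cvg_nneseries => n _ _; exact: atom_measure_ge0.
rewrite /atom_measure /evaluation counting_esum setI_bigcupr.
rewrite nneseries_sum_bigcup//; last exact: trivIset_setIl.
by apply: eq_eseriesr => i _; rewrite counting_esum.
Qed.

HB.instance Definition _ phi := isMeasure.Build _ (borel Z) R (atom_measure phi)
  (atom_measure0 phi) (@atom_measure_ge0 phi) (@atom_measure_sigma_additive phi).

(** Enumerating the atoms writes the measure as a countable sum of Dirac masses; the
definition by [evaluation] is the one whose measurability in [phi] is known. *)
Lemma integral_atom_measure phi (u : borel Z -> \bar R) :
  measurable_fun setT u -> (forall z, 0 <= u z) ->
  \int[atom_measure phi]_z u z = \esum_(z in atoms phi) u z.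
Proof.
move=> mu u0.
have /countable_bijP[B] := countable_atoms phi.
rewrite card_eq_sym => /card_set_bijP[e be].
have [_ einj _] := be.
pose m_ n : {measure set (borel Z) -> \bar R} :=
  if n \in B as _ return {measure set (borel Z) -> \bar R}
  then @dirac _ (borel Z) (e n) R else mzero.
have seriesE (v : Z -> \bar R) : (forall z, 0 <= v z) ->
    \esum_(z in atoms phi) v z = \sum_(n <oo) (if n \in B then v (e n) else 0).
  move=> v0; rewrite (reindex_esum B _ e)// esum_mkcond nneseries_esumT// => n.
  by case: ifP.
rewrite (eq_measure_integral (mseries m_ 0)).
  rewrite ge0_integral_measure_series// seriesE//; apply: eq_eseriesr => n _.
  rewrite /m_; case: ifPn => // _; last by rewrite integral_measure_zero.
  by rewrite integral_dirac// diracT mul1e.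
move=> A mA _; rewrite /= /atom_measure evaluation_esum seriesE.
  rewrite /mseries; apply: eq_eseriesr => n _.
  by rewrite /m_; case: ifPn.
by move=> z; rewrite lee_fin.
Qed.

End atom_measure.

Section measurable_sums.
Context {R : realType} {d : nat} {K : ptopologicalType}.
Local Notation Z := ('rV[R]_d * K)%type.

Lemma measurable_evaluation (B : set Z) : measurable (B : set (borel Z)) ->
  measurable_fun setT (evaluation B : configs R d K -> \bar R).
Proof.
move=> mB _ Y mY; rewrite setTI; apply: sub_sigma_algebra.
by exists B => //; exists Y => //; rewrite setTI.
Qed.

(** The evaluations generate the sigma-algebra of the space of configurations. *)
Lemma measurable_fun_configs dX (X : measurableType dX) (f : X -> configs R d K) :
  (forall B : set Z, measurable (B : set (borel Z)) ->
    measurable_fun setT (fun x => evaluation B (f x))) ->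
  measurable_fun setT f.
Proof.
move=> h; apply: (@measurability _ _ X (configs R d K) setT f (@evaluation_system R d K)) => //.
move=> _ [_ [B mB [Y mY <-]] <-]; rewrite !setTI.
by rewrite -[X in measurable X]setTI; exact: (h B).
Qed.

Import HBNNSimple.

Variables (dX : measure_display) (X : measurableType dX).
Variables (f : X -> configs R d K) (mf : measurable_fun setT f).

Let kf x : {measure set (borel Z) -> \bar R} := atom_measure (f x).

Let measurable_kf U : measurable U -> measurable_fun setT (kf ^~ U).
Proof. by move=> mU; apply: measurableT_comp mf; exact: measurable_evaluation. Qed.

HB.instance Definition _ := isKernel.Build _ _ X (borel Z) R kf measurable_kf.

Let near_origin n : set (borel Z) := [set z | (`|z.1| <= n%:R)%R].

Let measurable_near_origin n : measurable (near_origin n).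
Proof.
have -> : near_origin n = (fst : borel Z -> borel 'rV[R]_d) @^-1` [set x | (`|x| <= n%:R)%R].
  by [].
rewrite -[X in measurable X]setTI.
apply: (@continuous_borel Z 'rV[R]_d fst) => //.
  by move=> z; exact: cvg_fst.
rewrite -[X in measurable X]setCK; apply: measurableC; apply: borel_open.
rewrite openC; apply: (closed_comp _ (@closed_le R n%:R)) => x _.
exact: norm_continuous.
Qed.

(** The kernel need not be finite, but its restriction to the atoms within a given
distance of the origin is finite at every [x], by local finiteness; let the
distance tend to infinity. *)
Let measurable_xsection_atoms (A : set (X * borel Z)) : measurable A ->
  measurable_fun setT (fun x => kf x (xsection A x)).
Proof.
move=> mA.
have m n : measurable_fun setT
    (fun x => mrestr (kf x) (measurable_near_origin n) (xsection A x)).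
  have [|//] := @measurable_prod_subset_xsection_kernel _ _ _ _ _ kf
    (near_origin n) (measurable_near_origin n) _ A mA.
  move=> x; exists (fine (kf x (near_origin n)) + 1)%R => U mU.
  have fn : kf x (near_origin n) \is a fin_num.
    by rewrite /kf/= /atom_measure /evaluation /counting asboolT//; exact: atoms_fin.
  rewrite EFinD fineK// (@le_lt_trans _ _ (kf x (near_origin n)))//.
    by rewrite /mrestr; apply: le_measure; rewrite ?inE//; exact: measurableI.
  by rewrite lteDl// lte_fin.
apply: (emeasurable_fun_cvg (fun n x => mrestr (kf x) (measurable_near_origin n) (xsection A x))) => // x _.
have -> : kf x (xsection A x) = kf x (\bigcup_n (xsection A x `&` near_origin n)).
  congr (kf x _); rewrite -setI_bigcupr setIidl// => z _.
  by exists (Num.truncn `|z.1|).+1 => //=; exact/ltW/Num.Theory.truncnS_gt.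
apply: (nondecreasing_cvg_mu (F := fun n => xsection A x `&` near_origin n)).
- by move=> n; apply: measurableI => //; exact: measurable_xsection.
- by apply: bigcup_measurable => n _; apply: measurableI => //; exact: measurable_xsection.
- move=> a b ab; apply/subsetPset; apply: setIS => z /= /le_trans; apply.
  by rewrite ler_nat.
Qed.

(** The workhorse for measurability: a random configuration is a kernel, and the
sum is the integral of [u (x, _)] against it. *)
Lemma measurable_esum_atoms (u : X * borel Z -> \bar R) :
  (forall p, 0 <= u p) -> measurable_fun setT u ->
  measurable_fun setT (fun x => \esum_(z in atoms (f x)) u (x, z)).
Proof.
move=> u0 mu; pose u_ := nnsfun_approx measurableT mu.
have := @measurable_fun_xsection_integral _ _ X (borel Z) R u kf u_.
rewrite (_ : (fun x => \int[kf x]_y u (x, y)) =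
    (fun x => \esum_(z in atoms (f x)) u (x, z))); last first.
  apply/funext => x; rewrite /kf/= integral_atom_measure//.
  exact: measurableT_comp.
apply => //.
- by move=> a b ab; exact/nd_nnsfun_approx.
- by move=> z; exact/cvg_nnsfun_approx.
- move=> n r; apply: measurable_xsection_atoms.
  by rewrite -[X in measurable X]setTI; apply: (measurable_funP (u_ n)).
Qed.

End measurable_sums.

(** * Shifts, projections and markings by a function of the base process *)

Lemma config_eq (R : realType) (d : nat) (K : topologicalType)
  (phi psi : configs R d K) : atoms phi = atoms psi -> phi = psi.
Proof.
case: phi psi => [A fA iA] [B fB iB] /= AB; case: _ / AB in fB iB *.
by congr Config; exact: Prop_irrelevance.
Qed.

Section shift_project.
Context {R : realType} {d : nat}.

Lemma shiftD (K : topologicalType) (x y : 'rV[R]_d) (phi : configs R d K) :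
  shift x (shift y phi) = shift (y + x)%R phi.
Proof.
apply: config_eq; apply/seteqP; split=> [_ [_ [z pz <-] <-]|_ [z pz <-]] /=.
  by exists z => //=; rewrite opprD addrA.
by exists (z.1 - y, z.2)%R; [exists z|rewrite /= opprD addrA].
Qed.

Lemma with_origin_shift (K : topologicalType) (phi : configs R d K) z :
  atoms phi z -> with_origin (shift z.1 phi).
Proof. by case: z => x k pz; exists k; exists (x, k) => //=; rewrite subrr. Qed.

Lemma project_shift (M M' : topologicalType) (y : 'rV[R]_d)
    (psi : configs R d (M * M')%type) :
  project (shift y psi) = shift y (project psi).
Proof.
apply: config_eq; apply/seteqP; split=> [_ [_ [z pz <-] <-]|_ [_ [z pz <-] <-]] /=.
  by exists (z.1, z.2.1) => //; exists z.
by exists (z.1 - y, z.2)%R => //; exists z.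
Qed.

Lemma esum_shift (K : topologicalType) (y : 'rV[R]_d) (phi : configs R d K)
    (a : 'rV[R]_d * K -> \bar R) :
  \esum_(z in atoms (shift y phi)) a z = \esum_(z in atoms phi) a (z.1 - y, z.2)%R.
Proof.
rewrite /= esum_image// => -[x1 k1] [x2 k2] _ _ /= [/addIr -> ->] //.
Qed.

Lemma esum_project (M M' : topologicalType) (psi : configs R d (M * M')%type)
    (a : 'rV[R]_d * M -> \bar R) :
  \esum_(z in atoms (project psi)) a z = \esum_(z in atoms psi) a (z.1, z.2.1).
Proof.
rewrite /= esum_image// => -[x1 [k1 k1']] [x2 [k2 k2']] /set_mem p1 /set_mem p2 /= [x12 _].
by rewrite -x12 in p2 *; rewrite (atoms_inj p1 p2).
Qed.

Lemma evaluation_eq0 (K : ptopologicalType) (B : set ('rV[R]_d * K)) (phi : configs R d K) :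
  evaluation B phi = 0 <-> forall z, atoms phi z -> ~ B z.
Proof.
rewrite evaluation_esum esum_eq0P; last by move=> z _; rewrite lee_fin.
split=> h z pz; have := h z pz; rewrite indicE.
  by case: (boolP (z \in B)) => [_ /eqP|/negP]; rewrite ?inE// eqe oner_eq0.
by move=> nB; rewrite memNset.
Qed.

End shift_project.

Section measurability_of_operations.
Context {R : realType} {d : nat} {K : ptopologicalType}.
Hypothesis sK : @second_countable K.
Local Notation Z := ('rV[R]_d * K)%type.
Variables (dX : measure_display) (X : measurableType dX).

Lemma measurable_subV (a b : X -> 'rV[R]_d) :
  @measurable_fun _ _ X (borel 'rV[R]_d) setT a ->
  @measurable_fun _ _ X (borel 'rV[R]_d) setT b ->
  @measurable_fun _ _ X (borel 'rV[R]_d) setT (fun x => a x - b x)%R.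
Proof.
move=> ma mb.
apply: (@measurableT_comp _ _ _ X (borel ('rV[R]_d * 'rV[R]_d)%type) (borel 'rV[R]_d)
  (fun p => (p.1 - p.2)%R) _ (fun x => (a x, b x))).
  apply: (@continuous_borel ('rV[R]_d * 'rV[R]_d)%type) => -[x y].
  by apply: cvgB; [exact: cvg_fst|exact: cvg_snd].
by apply: measurable_pair_borel => //; exact: second_countable_rV.
Qed.

Lemma measurable_fst_borel (A B : ptopologicalType) (f : X -> A * B) :
  @measurable_fun _ _ X (borel (A * B)%type) setT f ->
  @measurable_fun _ _ X (borel A) setT (fun x => (f x).1).
Proof.
move=> mf; apply: (@measurableT_comp _ _ _ X (borel (A * B)%type) (borel A) fst) => //.
by apply: (@continuous_borel (A * B)%type) => z; exact: cvg_fst.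
Qed.

Lemma measurable_snd_borel (A B : ptopologicalType) (f : X -> A * B) :
  @measurable_fun _ _ X (borel (A * B)%type) setT f ->
  @measurable_fun _ _ X (borel B) setT (fun x => (f x).2).
Proof.
move=> mf; apply: (@measurableT_comp _ _ _ X (borel (A * B)%type) (borel B) snd) => //.
by apply: (@continuous_borel (A * B)%type) => z; exact: cvg_snd.
Qed.

Lemma measurable_esum_atoms_indic (f : X -> configs R d K) (T : ptopologicalType)
    (g : X * borel Z -> T) (B : set T) :
  measurable_fun setT f -> @measurable_fun _ _ _ (borel T) setT g ->
  measurable (B : set (borel T)) ->
  measurable_fun setT (fun x => \esum_(z in atoms (f x)) (\1_B (g (x, z)))%:E : \bar R).
Proof.
move=> mf mg mB.
apply: (@measurable_esum_atoms R d K _ X f mf (fun p => (\1_B (g p))%:E)).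
  by move=> p; rewrite lee_fin.
have mi : @measurable_fun _ _ (borel T) R setT (\1_B) by exact: measurable_indic.
by apply/measurable_EFinP; exact: (measurableT_comp mi mg).
Qed.

End measurability_of_operations.

Section measurability_of_config_maps.
Context {R : realType} {d : nat} {K : ptopologicalType}.
Hypothesis sK : @second_countable K.
Local Notation Z := ('rV[R]_d * K)%type.
Variables (dX : measure_display) (X : measurableType dX).

Lemma measurable_shift (y : X -> 'rV[R]_d) (f : X -> configs R d K) :
  @measurable_fun _ _ X (borel 'rV[R]_d) setT y ->
  measurable_fun setT f ->
  measurable_fun setT (fun x => shift (y x) (f x)).
Proof.
move=> my mf; apply: measurable_fun_configs => B mB.
under eq_fun do rewrite evaluation_esum esum_shift.
apply: (@measurable_esum_atoms_indic _ _ _ _ _ f Z (fun p => (p.2.1 - y p.1, p.2.2)%R)) => //.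
apply: measurable_pair_borel => //; first exact: second_countable_rV.
  apply: measurable_subV; first exact: (measurable_fst_borel measurable_snd).
  exact: (measurableT_comp my measurable_fst).
exact: (measurable_snd_borel measurable_snd).
Qed.

(** The configurations without a point at the origin are those which give mass 0
to the closed set of locations equal to the origin. *)
Lemma measurable_with_origin : measurable (@with_origin R d K).
Proof.
pose O : set Z := [set z | z.1 = 0%R].
have mO : measurable (O : set (borel Z)).
  have -> : O = fst @^-1` [set (0 : 'rV[R]_d)%R] by [].
  rewrite -[X in measurable X]setTI.
  apply: (@continuous_borel Z 'rV[R]_d fst) => //; first by move=> z; exact: cvg_fst.
  rewrite -[X in measurable X]setCK; apply: measurableC; apply: borel_open.
  rewrite openC; apply: accessible_closed_set1; apply: hausdorff_accessible.
  exact: norm_hausdorff.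
have -> : @with_origin R d K = ~` [set phi | evaluation O phi = 0].
  apply/seteqP; split=> [phi [k pk] /evaluation_eq0 /(_ _ pk)|phi]; first exact.
  move=> /= n0; apply: contrapT => nO; apply: n0; apply: (evaluation_eq0 O phi).2 => -[x k] pz.
  by rewrite /O/= => x0; apply: nO; exists k; rewrite -x0.
apply: measurableC; rewrite -[X in measurable X]setTI.
exact: (measurable_evaluation mO measurableT (emeasurable_set1 0)).
Qed.

End measurability_of_config_maps.

Section mark_by.
Context {R : realType} {d : nat}.
Variables (M M' : topologicalType) (m : configs R d M -> M').
Implicit Type phi : configs R d M.

Let marked phi : set ('rV[R]_d * (M * M')) :=
  [set (z.1, (z.2, m (shift z.1 phi))) | z in atoms phi].

Let mark_by_fin phi (r : R) : finite_set (marked phi `&` [set z | (`|z.1| <= r)%R]).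
Proof.
apply: (@sub_finite_set _ _ ((fun z : 'rV[R]_d * M => (z.1, (z.2, m (shift z.1 phi)))) @`
  (atoms phi `&` [set z | (`|z.1| <= r)%R]))).
  by move=> _ [[z pz <-]] /= zr; exists z.
exact/finite_image/atoms_fin.
Qed.

Let mark_by_inj phi x k k' : marked phi (x, k) -> marked phi (x, k') -> k = k'.
Proof.
move=> [[a l] /= phia [<- <-]] [[b l'] /= phib [ab <-]].
by move: phib; rewrite ab => phib; rewrite (atoms_inj phia phib).
Qed.

(** Marks each point by the value of [m] at the configuration seen from it.  It
is a shift-equivariant function of the base process, so it preserves
stationarity. *)
Definition mark_by phi : configs R d (M * M')%type :=
  Config (@mark_by_fin phi) (@mark_by_inj phi).

Lemma project_mark_by phi : project (mark_by phi) = phi.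
Proof.
apply: config_eq; apply/seteqP; split=> [_ [_ [z pz <-] <-]|[x k] pz] /=.
  by rewrite -surjective_pairing.
by exists (x, (k, m (shift x phi))) => //; exists (x, k).
Qed.

Lemma mark_by_shift y phi : mark_by (shift y phi) = shift y (mark_by phi).
Proof.
apply: config_eq; apply/seteqP; split=> [_ [_ [z pz <-] <-]|_ [_ [z pz <-] <-]] /=.
  exists (z.1, (z.2, m (shift z.1 phi))); first by exists z.
  by rewrite /= shiftD [(y + _)%R]addrC subrK.
exists (z.1 - y, z.2)%R; first by exists z.
by rewrite /= shiftD [(y + _)%R]addrC subrK.
Qed.

Lemma esum_mark_by phi (a : 'rV[R]_d * (M * M') -> \bar R) :
  \esum_(z in atoms (mark_by phi)) a z =
  \esum_(z in atoms phi) a (z.1, (z.2, m (shift z.1 phi))).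
Proof. by rewrite /= esum_image// => -[x1 k1] [x2 k2] _ _ /= [-> ->] //. Qed.

(** A marked configuration whose marks follow the rule [m] is recovered from its base
process; this is what makes the law of such a marking unique. *)
Lemma mark_by_projectP (psi : configs R d (M * M')%type) :
  (forall z, atoms psi z -> z.2.2 = m (shift z.1 (project psi))) ->
  mark_by (project psi) = psi.
Proof.
move=> h; apply: config_eq; apply/seteqP; split=> [_ [_ [z pz <-] <-]|[x [k k']] pz] /=.
  by rewrite -(h z pz); case: z pz => x [].
by exists (x, k); [exists (x, (k, k'))|rewrite /= -(h _ pz)].
Qed.

End mark_by.

Section measurable_marks.
Context {R : realType} {d : nat} {M M' : ptopologicalType}.
Hypotheses (sM : @second_countable M) (sM' : @second_countable M').

Lemma measurable_project :
  measurable_fun setT (@project R d M M').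
Proof.
apply: measurable_fun_configs => B mB.
under eq_fun do rewrite evaluation_esum esum_project.
apply: (@measurable_esum_atoms_indic R d (M * M')%type _ _ id
  ('rV[R]_d * M)%type (fun p => (p.2.1, p.2.2.1))) => //.
have m2 := @measurable_snd _ _ (configs R d (M * M')%type) (borel ('rV[R]_d * (M * M'))%type).
apply: measurable_pair_borel => //; first exact: second_countable_rV.
  exact: (measurable_fst_borel m2).
exact: (measurable_fst_borel (measurable_snd_borel m2)).
Qed.

Lemma measurable_mark_by (m : configs R d M -> M') :
  @measurable_fun _ _ (configs R d M) (borel M') setT m ->
  measurable_fun setT (mark_by m).
Proof.
move=> mm; apply: measurable_fun_configs => B mB.
under eq_fun do rewrite evaluation_esum esum_mark_by.
apply: (@measurable_esum_atoms_indic R d M _ _ id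
  ('rV[R]_d * (M * M'))%type (fun p => (p.2.1, (p.2.2, m (shift p.2.1 p.1))))) => //.
have m2 := @measurable_snd _ _ (configs R d M) (borel ('rV[R]_d * M)%type).
apply: measurable_pair_borel => //; first exact: second_countable_rV.
- exact: second_countable_prod.
- exact: (measurable_fst_borel m2).
- apply: measurable_pair_borel => //; first exact: (measurable_snd_borel m2).
  apply: (measurableT_comp mm); apply: measurable_shift => //.
  exact: (measurable_fst_borel m2).
Qed.

End measurable_marks.

(** * Countable sums and the cells of the integer lattice *)

Section countable_sums.
Context {R : realType}.

Lemma esum_pickle (I : countType) (a : I -> \bar R) : (forall i, 0 <= a i) ->
  \esum_(i in [set: I]) a i = \sum_(n <oo) oapp a 0 (pickle_inv n).
Proof.
move=> a0; rewrite nneseries_esumT; last by move=> n; case: pickle_inv => //=.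
transitivity (\esum_(n in choice.pickle @` [set: I]) oapp a 0 (pickle_inv n)).
  rewrite esum_image; last by move=> x y _ _ /(pcan_inj choice.pickleK).
  by apply: eq_esum => i _; rewrite pickleK_inv.
rewrite esum_mkcond; apply: eq_esum => n _; case: ifPn => // /negP nI.
case E : pickle_inv => [i|]//=; exfalso; apply: nI; rewrite inE; exists i => //.
by have := @pickle_invK I n; rewrite /ocancel E.
Qed.

Lemma integral_esum_countable dX (X : measurableType dX)
    (mu : {measure set X -> \bar R}) (I : countType) (h : I -> X -> \bar R) :
  (forall i x, 0 <= h i x) -> (forall i, measurable_fun setT (h i)) ->
  \int[mu]_x (\esum_(i in [set: I]) h i x) = \esum_(i in [set: I]) \int[mu]_x h i x.
Proof.
move=> h0 mh; rewrite esum_pickle; last by move=> i; exact: integral_ge0.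
under eq_integral do rewrite esum_pickle//.
rewrite integral_nneseries//.
- apply: eq_eseriesr => n _; case: pickle_inv => [i|]//=.
  by rewrite integral0.
- by move=> n; case: pickle_inv => [i|]//=.
- by move=> n x _; case: pickle_inv => [i|]//=.
Qed.

End countable_sums.

Section esum_atoms_in.
Context {R : realType} {d : nat} {K : ptopologicalType}.
Local Notation Z := ('rV[R]_d * K)%type.

Lemma measurable_esum_atoms_in dX (X : measurableType dX) (f : X -> configs R d K)
    (A : set (X * borel Z)) (u : X * borel Z -> \bar R) :
  measurable_fun setT f -> measurable A ->
  (forall p, 0 <= u p) -> measurable_fun setT u ->
  measurable_fun setT (fun x => \esum_(z in atoms (f x) `&` [set z | A (x, z)]) u (x, z)).
Proof.
move=> mf mA u0 mu.
rewrite (_ : (fun x => _) = (fun x => \esum_(z in atoms (f x)) (u \_ A) (x, z))).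
  apply: measurable_esum_atoms => //.
    by move=> p; rewrite patchE; case: ifP.
  by apply/(measurable_restrictT _ mA); exact: measurable_funTS.
apply/funext => x; rewrite esum_mkcondr; apply: eq_esum => z _.
by rewrite patchE; congr (if _ then _ else _); apply/idP/idP; rewrite !inE.
Qed.

End esum_atoms_in.

Section cells.
Context {R : realType} {d : nat}.
Implicit Type x : 'rV[R]_d.

Lemma measurable_coord_lt (i : 'I_d) (a : R) :
  measurable ([set x | (x ord0 i < a)%R] : set (borel 'rV[R]_d)).
Proof.
apply: borel_open.
apply: (@open_comp _ _ (fun x : 'rV[R]_d => x ord0 i) [set r : R | (r < a)%R]); last exact: open_lt.
by move=> x _; exact: coord_continuous.
Qed.

Lemma measurable_coord_ge (i : 'I_d) (a : R) :
  measurable ([set x | (a <= x ord0 i)%R] : set (borel 'rV[R]_d)).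
Proof.
rewrite (_ : [set x | _] = ~` [set x | (x ord0 i < a)%R]).
  by apply: measurableC; exact: measurable_coord_lt.
by apply/seteqP; split=> x /=; rewrite leNgt => /negP.
Qed.

Lemma measurable_coord_le (i : 'I_d) (a : R) :
  measurable ([set x | (x ord0 i <= a)%R] : set (borel 'rV[R]_d)).
Proof.
rewrite (_ : [set x | _] = ~` [set x | (a < x ord0 i)%R]).
  apply: measurableC; apply: borel_open.
  apply: (@open_comp _ _ (fun x : 'rV[R]_d => x ord0 i) [set r : R | (a < r)%R]); last exact: open_gt.
  by move=> x _; exact: coord_continuous.
by apply/seteqP; split=> x /=; rewrite leNgt => /negP.
Qed.

Lemma measurable_unit_cube : measurable (@unit_cube R d : set (borel 'rV[R]_d)).
Proof.
rewrite (_ : @unit_cube R d = \bigcap_(i in [set: 'I_d])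
    ([set x | (0 <= x ord0 i)%R] `&` [set x | (x ord0 i <= 1)%R])).
  apply: fin_bigcap_measurable => // i _.
  by apply: measurableI; [exact: measurable_coord_ge|exact: measurable_coord_le].
apply/seteqP; split=> [x cx i _|x h i]; first by have /andP := cx i.
by apply/andP; exact: h.
Qed.

(** The corner of the half-open unit cell of the integer lattice that contains
[x].  Unlike the translates of the closed cube [unit_cube], these cells form a
partition. *)
Definition cell x : 'rV[int]_d := map_mx Num.floor x.

Definition lattice (k : 'rV[int]_d) : 'rV[R]_d := map_mx intr k.

Lemma cell_eqP x k :
  cell x = k <-> forall i, ((k ord0 i)%:~R <= x ord0 i < (k ord0 i + 1)%:~R)%R.
Proof.
split=> [<- i|h]; first by rewrite mxE Num.Theory.floor_itv// Num.Theory.num_real.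
apply/rowP => i; rewrite mxE; apply: Num.Theory.floor_def; exact: h.
Qed.

Lemma measurable_cell k : measurable ([set x | cell x = k] : set (borel 'rV[R]_d)).
Proof.
rewrite (_ : [set x | cell x = k] = \bigcap_(i in [set: 'I_d])
    ([set x | ((k ord0 i)%:~R <= x ord0 i)%R] `&`
     [set x | (x ord0 i < (k ord0 i + 1)%:~R)%R])).
  apply: fin_bigcap_measurable => // i _.
  by apply: measurableI; [exact: measurable_coord_ge|exact: measurable_coord_lt].
apply/seteqP; split=> [x /cell_eqP h i _|x h]; first by have /andP := h i.
by apply/cell_eqP => i; apply/andP; exact: h.
Qed.

Lemma cell_subr_lattice x k : cell (x - lattice k)%R = (cell x - k)%R.
Proof.
apply/rowP => i; rewrite !mxE -mulrNz Num.Theory.floorDrz ?intr_int//.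
by rewrite Num.Theory.intrKfloor.
Qed.

Lemma subr_lattice_cell x : unit_cube (x - lattice (cell x))%R.
Proof.
move=> i; rewrite !mxE subr_ge0 Num.Theory.floor_le_tmp lerBlDr.
by rewrite -[1%R]/(1%:~R) -intrD ltW// addrC Num.Theory.floorD1_gt.
Qed.

Lemma cell0_unit_cube x : cell x = 0%R -> unit_cube x.
Proof.
move=> /cell_eqP h i; have := h i; rewrite mxE => /andP[-> /ltW]/=.
by rewrite add0r.
Qed.

Lemma unit_cube_cell0 x : unit_cube x -> (forall i, x ord0 i != 1%R) -> cell x = 0%R.
Proof.
move=> cx x1; apply/cell_eqP => i; have /andP[x0 xle] := cx i.
by rewrite mxE x0 add0r lt_neqAle x1 xle.
Qed.

End cells.

(** * Stationarity, Palm almost sure properties and mass transport *)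

Lemma ge0_integral_eq0P {R : realType} dX (X : measurableType dX)
    (mu : {measure set X -> \bar R}) (f : X -> \bar R) :
  measurable_fun setT f -> (forall x, 0 <= f x) ->
  \int[mu]_x f x = 0 <-> {ae mu, forall x, f x = 0}.
Proof.
move=> mf f0; have -> : \int[mu]_x f x = \int[mu]_x `|f x|.
  by apply: eq_integral => x _; rewrite gee0_abs.
rewrite (ae_eq_integral_abs mu measurableT mf); split=> -[N [mN N0 Nf]].
  by exists N; split=> // x /= fx; apply: Nf => /= /(_ I).
by exists N; split=> // x /= /not_implyP[_ fx]; exact: Nf.
Qed.

Lemma ae_imp {R : realType} dX (X : measurableType dX)
    (mu : {measure set X -> \bar R}) (P Q : X -> Prop) : (forall x, P x -> Q x) ->
  {ae mu, forall x, P x} -> {ae mu, forall x, Q x}.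
Proof. by move=> PQ; apply: filterS. Qed.

Lemma ae_imp2 {R : realType} dX (X : measurableType dX)
    (mu : {measure set X -> \bar R}) (P Q S : X -> Prop) :
  (forall x, P x -> Q x -> S x) ->
  {ae mu, forall x, P x} -> {ae mu, forall x, Q x} -> {ae mu, forall x, S x}.
Proof. by move=> PQS; apply: filterS2. Qed.

Section stationary.
Context {R : realType} {d : nat} {K : ptopologicalType}.
Hypothesis sK : @second_countable K.
Local Notation Z := ('rV[R]_d * K)%type.
Variables (L : probability (configs R d K) R) (sL : stationary L).

Lemma measurable_shiftT (y : 'rV[R]_d) :
  measurable_fun setT (shift y : configs R d K -> configs R d K).
Proof.
apply: (@measurable_shift _ _ _ sK _ _ (fun=> y) id) => //.
Qed.

Lemma integral_shift (y : 'rV[R]_d) (g : configs R d K -> \bar R) :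
  measurable_fun setT g -> (forall phi, 0 <= g phi) ->
  \int[L]_phi g (shift y phi) = \int[L]_phi g phi.
Proof.
move=> mg g0.
have := @ge0_integral_pushforward _ _ _ _ R _ (measurable_shiftT y) L setT g measurableT mg.
rewrite preimage_setT => <-; last by move=> phi _.
apply: (eq_measure_integral L) => [|my A mA _]; first exact: measurable_shiftT.
by rewrite /= /pushforward sL.
Qed.

Lemma ae_countable (I : countType) (P : I -> configs R d K -> Prop) :
  (forall i, {ae L, forall phi, P i phi}) -> {ae L, forall phi, forall i, P i phi}.
Proof.
move=> h.
have h' : forall n, {ae L, forall phi, oapp (fun i => P i phi) True (pickle_inv n)}.
  move=> n; case: pickle_inv => [i|] /=; first exact: h.
  exact: aeW.
have := ae_foralln h'; apply: filterS => phi H i.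
by have := H (choice.pickle i); rewrite pickleK_inv.
Qed.

Lemma ae_shift (P : configs R d K -> Prop) (y : 'rV[R]_d) :
  {ae L, forall phi, P phi} -> {ae L, forall phi, P (shift y phi)}.
Proof.
move=> [N [mN LN NP]]; exists (shift y @^-1` N); split.
- by rewrite -[X in measurable X]setTI; exact: measurable_shiftT.
- by rewrite sL.
- by move=> phi /= nP; exact: NP.
Qed.

(** The lattice translates of the unit cube cover the space, and there are countably
many of them; each is reduced to the unit cube by stationarity. *)
Lemma ae_unit_cube_atoms (P : K -> configs R d K -> Prop) :
  {ae L, forall phi, forall z, atoms phi z -> unit_cube z.1 -> P z.2 (shift z.1 phi)} ->
  {ae L, forall phi, forall z, atoms phi z -> P z.2 (shift z.1 phi)}.
Proof.
move=> h.
have := ae_countable (fun k : 'rV[int]_d => ae_shift (lattice k) h).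
apply: filterS => phi H z pz.
have := H (cell z.1) (z.1 - lattice (cell z.1), z.2)%R.
rewrite /= shiftD [(lattice _ + _)%R]addrC subrK; apply; last exact: subr_lattice_cell.
by exists z.
Qed.

Lemma ae_evaluation_eq0 (A : set (configs R d K)) : measurable A ->
  \int[L]_phi evaluation [set z | unit_cube z.1 /\ A (shift z.1 phi)] phi = 0 <->
  {ae L, forall phi, forall z, atoms phi z -> ~ A (shift z.1 phi)}.
Proof.
move=> mA.
pose B : set (configs R d K * borel Z) :=
  [set p | unit_cube p.2.1 /\ A (shift p.2.1 p.1)].
have m2 := @measurable_snd _ _ (configs R d K) (borel Z).
have mB : measurable B.
  apply: measurableI.
    rewrite -[X in measurable X]setTI.
    exact: (measurable_fst_borel m2 measurableT measurable_unit_cube).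
  rewrite -[X in measurable X]setTI.
  have ms := measurable_shift sK (measurable_fst_borel m2) (@measurable_fst _ _ (configs R d K) (borel Z)).
  exact: ms.
have me : measurable_fun setT
    (fun phi => evaluation [set z | unit_cube z.1 /\ A (shift z.1 phi)] phi).
  rewrite (_ : (fun phi => _) =
    (fun phi => \esum_(z in atoms (id phi) `&` [set z | B (phi, z)]) 1)).
    by apply: (@measurable_esum_atoms_in _ _ _ _ _ id B (cst 1)).
  by apply/funext => phi; rewrite /evaluation counting_esum.
have e0 phi : 0 <= evaluation [set z | unit_cube z.1 /\ A (shift z.1 phi)] phi :> \bar R.
  by rewrite /evaluation counting_esum esum_ge0.
rewrite (ge0_integral_eq0P L me e0); split=> h.
  apply: (@ae_unit_cube_atoms (fun _ phi => ~ A phi)).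
  move: h; apply: ae_imp => phi /evaluation_eq0 h z pz cz Az.
  by apply: (h z pz).
move: h; apply: ae_imp => phi h; apply/evaluation_eq0 => z pz [_ Az].
exact: (h z pz).
Qed.

(** The Palm mass of [A] is, up to a positive factor, the expected number of points
of the unit cube from which [A] is seen; it vanishes when there are almost surely
no such points in the cube, that is, when there are none at all. *)
Lemma palm_aeP (P : configs R d K -> Prop) : 0 < intensity L < +oo ->
  {ae palm L, forall phi, P phi} <->
  exists2 A, measurable A &
    {ae L, forall phi, forall z, atoms phi z -> ~ A (shift z.1 phi)} /\
    (forall phi, ~ A phi -> P phi).
Proof.
move=> /andP[i0 ioo].
have c0 : (fine (intensity L))^-1%:E != 0 :> \bar R.
  by rewrite eqe invr_eq0 gt_eqF// fine_gt0// i0.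
split=> [[A [mA pA AP]]|[A mA [h AP]]].
  exists A => //; split; last by move=> phi nA; apply: contrapT => /AP.
  apply/ae_evaluation_eq0 => //; move/eqP : pA; rewrite /palm mule_eq0.
  by rewrite (negPf c0)/= => /eqP.
exists A; split => //; last by move=> phi nP; apply: contrapT => /AP.
by move/(ae_evaluation_eq0 mA) : h; rewrite /palm => ->; rewrite mule0.
Qed.

Lemma integral_unit_cube : intensity L = \int[L]_phi \esum_(z in atoms phi `&` [set z | unit_cube z.1]) 1.
Proof.
apply: eq_integral => phi _; rewrite /evaluation counting_esum; congr (esum _ _).
by apply/seteqP; split=> [z [? []]|z [? ?]].
Qed.

Let face (i : 'I_d) : set Z := [set z | unit_cube z.1 /\ z.1 ord0 i = 1%R].

Let measurable_face i : measurable (face i : set (borel Z)).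
Proof.
have mf := measurable_fst_borel (@measurable_id _ (borel Z) setT).
rewrite (_ : face i = (fst : borel Z -> borel 'rV[R]_d) @^-1`
  (@unit_cube R d `&` ([set x | (x ord0 i <= 1)%R] `&` [set x | (1 <= x ord0 i)%R]))).
  rewrite -[X in measurable X]setTI; apply: mf => //.
  apply: measurableI; first exact: measurable_unit_cube.
  by apply: measurableI; [exact: measurable_coord_le|exact: measurable_coord_ge].
apply/seteqP; split=> [z [cz /= ->] //|z /= [cz [z1 z2]]].
by split=> //; apply/eqP; rewrite eq_le; apply/andP.
Qed.

(** For every [N], the [N] translates of the face by [y n], [n < N], are disjoint
subsets of the cube, so the expected number of points on the face is at most the
intensity divided by [N]. *)
Let ae_face (i : 'I_d) : intensity L < +oo ->
  {ae L, forall phi, forall z, atoms phi z -> ~ face i z}.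
Proof.
(* The face translated by [y n] lies in the cube, 1 / (n + 1) away from the face. *)
move=> ioo; pose y n : 'rV[R]_d := (- n.+1%:R^-1 *: delta_mx ord0 i)%R.
have me := measurable_evaluation (measurable_face i).
have e0 phi : 0 <= evaluation (face i) phi :> \bar R.
  by rewrite evaluation_esum esum_ge0// => z _; rewrite lee_fin.
have yi n z : (z - y n)%R ord0 i = (z ord0 i + n.+1%:R^-1)%R.
  by rewrite !mxE !eqxx/= mulr1 opprK.
have le N : (\int[L]_phi evaluation (face i) phi) *+ N <= intensity L.
  have -> : (\int[L]_phi evaluation (face i) phi) *+ N =
      \sum_(n < N) \int[L]_phi evaluation (face i) (shift (y n) phi).
    under eq_bigr do rewrite integral_shift//.
    by rewrite big_const_ord iter_addr_0.
  rewrite -ge0_integral_sum//; last first.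
    by move=> n; apply: (measurableT_comp me); exact: measurable_shiftT.
  rewrite integral_unit_cube; apply: ge0_le_integral => //.
  - by move=> phi _; exact: sume_ge0.
  - apply: emeasurable_sum => n; apply: (measurableT_comp me); exact: measurable_shiftT.
  - have m2 := @measurable_snd _ _ (configs R d K) (borel Z).
    apply: (@measurable_esum_atoms_in _ _ _ _ _ id [set p | unit_cube p.2.1] (cst 1)) => //.
    rewrite -[X in measurable X]setTI.
    exact: (measurable_fst_borel m2 measurableT measurable_unit_cube).
  move=> phi _; under eq_bigr do rewrite evaluation_esum esum_shift.
  rewrite -esum_sum; last by move=> *; rewrite lee_fin.
  rewrite [leRHS]esum_mkcondr; apply: le_esum => z pz.
  (* At most one of the translates of the face contains the given atom. *)
  have [[n fn]|nf] := pselect (exists n : 'I_N, face i (z.1 - y n, z.2)%R).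
    rewrite (bigD1 n)//= indicE mem_set// big1 ?adde0; last first.
      move=> m mn; rewrite indicE memNset// => fm.
      have : n.+1%:R^-1%R = m.+1%:R^-1%R :> R.
        case: fn fm => _ /= z1 [_ /= z2]; rewrite !yi in z1 z2.
        by apply: (addrI (z.1 ord0 i)); rewrite z1 z2.
      move=> /invr_inj /eqP; rewrite eqr_nat eqSS => /eqP nm.
      by move/eqP : mn; apply; exact/val_inj.
    rewrite mem_set//= => j; case: fn => /= cz z1.
    have := cz j; rewrite !mxE/=.
    have [->|ji] := eqVneq j i; last by rewrite /= mulr0 subr0.
    rewrite /= mulr1 opprK.
    move: z1; rewrite yi => z1 _; rewrite -(lerD2r n.+1%:R^-1) z1 add0r.
    by rewrite invf_le1 ?ltr0n// ler1n/= -z1 lerDl invr_ge0.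
  rewrite big1 ?lee_fin; last first.
    by move=> n _; rewrite indicE memNset// => fn; apply: nf; exists n.
  by case: ifP.
have c0 : \int[L]_phi evaluation (face i) phi = 0.
  have c0 : 0 <= \int[L]_phi evaluation (face i) phi by exact: integral_ge0.
  have coo : \int[L]_phi evaluation (face i) phi < +oo.
    exact: (le_lt_trans (le 1%N) ioo).
  have cf : \int[L]_phi evaluation (face i) phi \is a fin_num by rewrite ge0_fin_numE.
  have If : intensity L \is a fin_num.
    by rewrite ge0_fin_numE// (le_trans _ (le 0%N)).
  apply/eqP; rewrite eq_le c0 andbT leNgt; apply/negP => cp.
  move: le If cf cp; move: (\int[L]_phi _) (intensity L) => [c||] [l||]//= le _ _.
  rewrite lte_fin => cp.
  have := le (Num.truncn (l / c)).+1; rewrite -EFin_natmul lee_fin -mulr_natr.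
  apply/negP; rewrite -ltNge mulrC -ltr_pdivrMr//.
  exact: Num.Theory.truncnS_gt.
move/(ge0_integral_eq0P L me e0) : c0; apply: ae_imp => phi.
by move/evaluation_eq0.
Qed.

(** The closed cube and the half-open cell differ by faces only.  Intensities are
defined with the closed cube, while mass transport needs a partition. *)
Lemma ae_unit_cube_cell : intensity L < +oo ->
  {ae L, forall phi, atoms phi `&` [set z | unit_cube z.1] =
                     atoms phi `&` [set z | cell z.1 = 0%R]}.
Proof.
move=> ioo; have := ae_countable (fun i => ae_face i ioo).
apply: filterS => phi h; apply/seteqP; split=> z [pz]; last by move/cell0_unit_cube.
move=> cz; split => //=; apply: unit_cube_cell0 => // i; apply/eqP => zi.
exact: (h i z pz).
Qed.

Lemma esum_shift_in (y : 'rV[R]_d) (phi : configs R d K) (A : set Z) (a : Z -> \bar R) :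
  \esum_(z in atoms (shift y phi) `&` A) a z =
  \esum_(z in atoms phi `&` [set z | A (z.1 - y, z.2)%R]) a (z.1 - y, z.2)%R.
Proof.
rewrite !esum_mkcondr esum_shift; apply: eq_esum => z _.
by congr (if _ then _ else _); apply/idP/idP; rewrite !inE.
Qed.

Lemma esum_cells (phi : configs R d K) (a : Z -> \bar R) : (forall z, 0 <= a z) ->
  \esum_(z in atoms phi) a z =
  \esum_(k in [set: 'rV[int]_d]) \esum_(z in atoms phi `&` [set z | cell z.1 = k]) a z.
Proof.
move=> a0; under [RHS]eq_esum do rewrite esum_mkcondr.
rewrite exchange_esum; last by move=> k z; case: ifP.
apply: eq_esum => z _.
rewrite -[LHS](@esum_set1 _ _ (cell z.1) (fun=> a z))// esum_mkcond; apply: eq_esum => k _.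
by congr (if _ then _ else _); apply/idP/idP; rewrite !inE/=.
Qed.

(** The mass sent from the cell at the origin to the cell at [l] has, by
stationarity, the same mean as the mass sent from the cell at [- l] to the cell at
the origin; sum over [l]. *)
Lemma mass_transport (g : Z -> Z -> configs R d K -> \bar R) :
  (forall z w phi, 0 <= g z w phi) ->
  measurable_fun setT (fun p : configs R d K * borel Z * borel Z => g p.1.2 p.2 p.1.1) ->
  (forall y z w phi, g (z.1 - y, z.2)%R (w.1 - y, w.2)%R (shift y phi) = g z w phi) ->
  \int[L]_phi (\esum_(z in atoms phi `&` [set z | cell z.1 = 0%R]) \esum_(w in atoms phi) g z w phi) =
  \int[L]_phi (\esum_(w in atoms phi `&` [set z | cell z.1 = 0%R]) \esum_(z in atoms phi) g z w phi).
Proof.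
move=> g0 mg ginv.
pose G k l (phi : configs R d K) : \bar R := \esum_(z in atoms phi `&` [set z | cell z.1 = k])
  \esum_(w in atoms phi `&` [set w | cell w.1 = l]) g z w phi.
have G0 k l phi : 0 <= G k l phi by apply: esum_ge0 => z _; exact: esum_ge0.
have mcell dX (X : measurableType dX) k :
    measurable ([set p : X * borel Z | cell p.2.1 = k]).
  have m2 := @measurable_snd _ _ X (borel Z).
  rewrite -[X in measurable X]setTI.
  exact: (measurable_fst_borel m2 measurableT (measurable_cell k)).
have mG k l : measurable_fun setT (G k l).
  apply: (@measurable_esum_atoms_in _ _ _ _ _ id [set p | cell p.2.1 = k]
    (fun p => \esum_(w in atoms p.1 `&` [set w | cell w.1 = l]) g p.2 w p.1)) => //.
    by move=> p; exact: esum_ge0.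
  by apply: (@measurable_esum_atoms_in _ _ _ _ (configs R d K * borel Z)%type fst
    [set p | cell p.2.1 = l] (fun q => g q.1.2 q.2 q.1.1)).
have Gshift k l t phi : G k l (shift (lattice t) phi) = G (k + t)%R (l + t)%R phi.
  have cellE u : [set z : Z | [set z | cell z.1 = u] (z.1 - lattice t, z.2)%R] =
      [set z | cell z.1 = (u + t)%R].
    apply/seteqP; split=> z /=; rewrite cell_subr_lattice; first by move=> <-; rewrite subrK.
    by move=> ->; rewrite addrK.
  rewrite /G esum_shift_in cellE; apply: eq_esum => z _.
  by rewrite esum_shift_in cellE; apply: eq_esum => w _; rewrite ginv.
have intG k l t : \int[L]_phi G k l phi = \int[L]_phi G (k + t)%R (l + t)%R phi.
  by rewrite -(integral_shift (lattice t) (mG k l))//; under eq_integral do rewrite Gshift.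
transitivity (\esum_(l in [set: 'rV[int]_d]) \int[L]_phi G 0%R l phi).
  rewrite -integral_esum_countable//; apply: eq_integral => phi _.
  rewrite /G [RHS]exchange_esum; last by move=> l z; exact: esum_ge0.
  by apply: eq_esum => z _; exact: esum_cells.
transitivity (\esum_(k in [set: 'rV[int]_d]) \int[L]_phi G k 0%R phi).
  rewrite (reindex_esum setT setT (fun k : 'rV[int]_d => (- k)%R)).
    by apply: eq_esum => k _; rewrite (intG _ _ k) add0r addNr.
  split=> [//|x y _ _ /oppr_inj//|k _].
  by exists (- k)%R; rewrite ?opprK.
rewrite -integral_esum_countable//; apply: eq_integral => phi _.
rewrite /G; under [LHS]eq_esum do rewrite exchange_esum//.
rewrite [LHS]exchange_esum; last by move=> l z; exact: esum_ge0.
by apply: eq_esum => z _; apply/esym; exact: esum_cells.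
Qed.

End stationary.

(** * Series of one sign and their expectations over the unit cube *)

Section subtractable.
Context {R : realType}.

(** The condition under which [p - n] determines [p] and [n] wherever [n] is finite,
and under which sums and integrals of [p - n] split: if the total of [n] is
infinite, both sides are [-oo], and otherwise [p] and [n] are the positive and the
negative part of [p - n]. *)
Definition subtractable (T : Type) (p n : T -> \bar R) :=
  (forall x, n x = 0 \/ n x = +oo) \/ (forall x, p x = 0).

Lemma subtractable_comp (T U : Type) (f : U -> T) (p n : T -> \bar R) :
  subtractable p n -> subtractable (p \o f) (n \o f).
Proof. by move=> [h|h]; [left|right] => x; exact: h. Qed.

Lemma esum_0y (T : choiceType) (S : set T) (n : T -> \bar R) :
  (forall x, n x = 0 \/ n x = +oo) ->
  \esum_(x in S) n x = 0 \/ \esum_(x in S) n x = +oo.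
Proof.
move=> h; have n0 x : 0 <= n x by case: (h x) => ->.
have [[x [Sx nx]]|nS] := pselect (exists x, S x /\ n x = +oo).
  right; apply/eqP; rewrite -leye_eq -nx; exact: le_esum_term.
left; apply: esum1 => x Sx; case: (h x) => // nx; exfalso; apply: nS.
by exists x.
Qed.

Lemma subtractable_esum (T : choiceType) (U : Type) (S : U -> set T) (p n : U -> T -> \bar R) :
  subtractable (fun q => p q.1 q.2) (fun q => n q.1 q.2) ->
  subtractable (fun u => \esum_(x in S u) p u x) (fun u => \esum_(x in S u) n u x).
Proof.
move=> [h|h]; [left|right] => u.
  by apply: esum_0y => x; exact: (h (u, x)).
by apply: esum1 => x _; exact: (h (u, x)).
Qed.

Lemma subtractable_funepos (T : Type) (p n : T -> \bar R) x :
  (forall x, 0 <= p x) -> (forall x, 0 <= n x) -> subtractable p n -> n x < +oo ->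
  maxe (p x - n x) 0 = p x.
Proof.
move=> p0 n0 [h|h] noo.
  by case: (h x) => nx; rewrite nx ?ltxx// sube0 in noo *; rewrite max_l.
by rewrite h sub0e max_r// oppe_le0.
Qed.

Lemma subtractable_funeneg (T : Type) (p n : T -> \bar R) x :
  (forall x, 0 <= p x) -> (forall x, 0 <= n x) -> subtractable p n ->
  maxe (- (p x - n x)) 0 = n x.
Proof.
move=> p0 n0 [h|h].
  case: (h x) => ->; first by rewrite sube0 max_r// oppe_le0.
  by rewrite addeNy /= max_l// leey.
by rewrite h sub0e oppeK max_l.
Qed.

(** If the sum of [n] is infinite, both sides are [-oo].  Otherwise [n] is finite on
[S], and there the positive part of [p - n] is [p]. *)
Lemma series_over_sub (T : choiceType) (S : set T) (p n : T -> \bar R) :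
  (forall x, 0 <= p x) -> (forall x, 0 <= n x) -> subtractable p n ->
  series_over S (fun z => p z - n z) = \esum_(z in S) p z - \esum_(z in S) n z.
Proof.
move=> p0 n0 pn; rewrite /series_over.
have -> : \esum_(z in S) (fun z => p z - n z)^\- z = \esum_(z in S) n z.
  by apply: eq_esum => x _; rewrite funenegE; exact: subtractable_funeneg.
have [noo|] := pselect (\esum_(z in S) n z = +oo); first by rewrite noo !addeNy.
move=> /eqP; rewrite -ltey => noo; congr (_ - _); apply: eq_esum => x Sx.
rewrite funeposE; apply: subtractable_funepos => //.
by apply: le_lt_trans noo; exact: le_esum_term.
Qed.

(** The analogue of [series_over_sub]: a finite integral makes [n] almost everywhere
finite. *)
Lemma integral_sub dX (X : measurableType dX) (mu : {measure set X -> \bar R})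
    (p n : X -> \bar R) :
  measurable_fun setT p -> measurable_fun setT n ->
  (forall x, 0 <= p x) -> (forall x, 0 <= n x) -> subtractable p n ->
  \int[mu]_x (p x - n x) = \int[mu]_x p x - \int[mu]_x n x.
Proof.
move=> mp mn p0 n0 pn; rewrite integralE.
have -> : \int[mu]_x (fun x => p x - n x)^\- x = \int[mu]_x n x.
  by apply: eq_integral => x _; rewrite funenegE; exact: subtractable_funeneg.
have [noo|] := pselect (\int[mu]_x n x = +oo); first by rewrite noo !addeNy.
move=> /eqP; rewrite -ltey => noo; congr (_ - _).
apply: ge0_ae_eq_integral => //.
  by apply: measurable_funepos; exact: emeasurable_funB.
have := @integrable_ae _ X R mu setT measurableT n.
have -> : mu.-integrable setT n.
  apply/integrableP; split => //.
  by under eq_integral do rewrite gee0_abs//.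
move=> /(_ isT) [N [mN N0 Nn]]; exists N; split => //.
move=> x /= h; apply: Nn => /= /(_ I) nx; apply: h => _.
rewrite funeposE; apply: subtractable_funepos => //.
by rewrite -ge0_fin_numE.
Qed.

(** The two ranges of the score function, completed by [+oo], a value that sums
may take. *)
Definition one_signed (T : Type) (a : T -> \bar R) :=
  (forall x, a x = -oo \/ 0 <= a x) \/ (forall x, a x <= 0).

Lemma one_signed_subtractable (T : Type) (a : T -> \bar R) :
  one_signed a -> subtractable a^\+ a^\-.
Proof.
move=> [h|h]; [left|right] => x; rewrite ?funenegE ?funeposE.
  case: (h x) => [->|a0]; [right|left]; first by rewrite max_l// leey.
  by rewrite max_r// oppe_le0.
by rewrite max_r.
Qed.

Lemma subtractable_one_signed (T : Type) (p n : T -> \bar R) :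
  (forall x, 0 <= p x) -> (forall x, 0 <= n x) ->
  subtractable p n -> one_signed (fun x => p x - n x).
Proof.
move=> p0 n0 [h|h]; [left|right] => x.
  by case: (h x) => ->; [right; rewrite sube0|left; rewrite addeNy].
by rewrite h sub0e oppe_le0.
Qed.

Lemma esum_eq_pointwise (T : choiceType) (S : set T) (u v : T -> \bar R) z :
  (forall x, 0 <= u x) -> (forall x, u x <= v x) ->
  \esum_(x in S) u x = \esum_(x in S) v x -> \esum_(x in S) v x < +oo ->
  S z -> u z = v z.
Proof.
move=> u0 uv uvS voo Sz.
have v0 x : 0 <= v x by exact: le_trans (uv x).
have split (a : T -> \bar R) : (forall x, 0 <= a x) -> \esum_(x in S) a x =
    a z + \esum_(x in S `&` ~` [set z]) a x.
  move=> a0; rewrite (esumID [set z])// (_ : S `&` [set z] = [set z]) ?esum_set1//.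
  by apply/seteqP; split=> [x []|x -> //].
have ruv : \esum_(x in S `&` ~` [set z]) u x <= \esum_(x in S `&` ~` [set z]) v x.
  by apply: le_esum => x _; exact: uv.
have rufin : \esum_(x in S `&` ~` [set z]) u x \is a fin_num.
  rewrite ge0_fin_numE ?esum_ge0//; apply: le_lt_trans voo.
  by apply: (le_trans ruv); rewrite (split v)// leeDr.
apply/eqP; rewrite eq_le uv/=.
rewrite -(leeD2rE _ _ rufin) -split// uvS split// leeD2l//.
Qed.

(** The extreme case of [p - m <= q - n]: equality of finite differences forces
equality of both parts. *)
Lemma sub_fin_eq (p q m n : \bar R) : 0 <= p -> 0 <= n -> p <= q -> n <= m ->
  p - m = q - n -> q - n \is a fin_num -> [/\ p = q, q < +oo, n = m & m < +oo].
Proof.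
move=> p0 n0 pq nm E fqn.
have /andP[fp fm] : (p \is a fin_num) && (- m \is a fin_num).
  by rewrite -fin_numD E.
have /andP[fq fn] : (q \is a fin_num) && (- n \is a fin_num) by rewrite -fin_numD.
rewrite !fin_numN in fm fn.
move: p q m n fp fq fm fn p0 n0 pq nm E {fqn} => [p||]// [q||]// [m||]// [n||]// _ _ _ _.
rewrite !lee_fin => p0 n0 pq nm [E].
by split; rewrite ?ltry//; congr EFin; lra.
Qed.

End subtractable.

Section cube_sums.
Context {R : realType} {d : nat} {K : ptopologicalType}.
Local Notation Z := ('rV[R]_d * K)%type.
Implicit Types (a b u v : Z -> configs R d K -> \bar R).

Definition cube_sum u (phi : configs R d K) : \bar R :=
  \esum_(z in atoms phi `&` [set z | unit_cube z.1]) u z phi.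

Definition mark_measurable u :=
  measurable_fun setT (fun p : configs R d K * borel Z => u p.2 p.1).

Lemma measurable_cube_sum u : (forall z phi, 0 <= u z phi) ->
  mark_measurable u -> measurable_fun setT (cube_sum u).
Proof.
move=> u0 mu.
apply: (@measurable_esum_atoms_in _ _ _ _ _ id [set p | unit_cube p.2.1]
  (fun p => u p.2 p.1)) => //.
rewrite -[X in measurable X]setTI.
have m2 := @measurable_snd _ _ (configs R d K) (borel Z).
exact: (measurable_fst_borel m2 measurableT measurable_unit_cube).
Qed.

Lemma cube_sum_ge0 u phi : (forall z phi, 0 <= u z phi) -> 0 <= cube_sum u phi.
Proof. by move=> u0; exact: esum_ge0. Qed.

Variable L : probability (configs R d K) R.

Definition cube_integral a : \bar R :=
  \int[L]_phi series_over (atoms phi `&` [set z | unit_cube z.1]) (a ^~ phi).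

Definition one_signed2 a := one_signed (fun p : Z * configs R d K => a p.1 p.2).

Lemma cube_integral_sub u v : (forall z phi, 0 <= u z phi) -> (forall z phi, 0 <= v z phi) ->
  mark_measurable u -> mark_measurable v ->
  subtractable (fun p : Z * configs R d K => u p.1 p.2) (fun p => v p.1 p.2) ->
  cube_integral (fun z phi => u z phi - v z phi) =
  \int[L]_phi cube_sum u phi - \int[L]_phi cube_sum v phi.
Proof.
move=> u0 v0 mu mv uv; rewrite -integral_sub.
- apply: eq_integral => phi _; rewrite series_over_sub//.
  exact: (subtractable_comp (fun z => (z, phi)) uv).
- exact: measurable_cube_sum.
- exact: measurable_cube_sum.
- by move=> phi; exact: cube_sum_ge0.
- by move=> phi; exact: cube_sum_ge0.
- apply: (@subtractable_esum _ _ _ _ (fun phi z => u z phi) (fun phi z => v z phi)).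
  exact: (subtractable_comp (fun q => (q.2, q.1)) uv).
Qed.

Let pos a := fun z phi => maxe (a z phi) 0.
Let neg a := fun z phi => maxe (- a z phi) 0.

Lemma mark_measurable_pos a : mark_measurable a -> mark_measurable (pos a).
Proof. by move=> ma; apply: measurable_maxe => //; exact: measurable_cst. Qed.

Lemma mark_measurable_neg a : mark_measurable a -> mark_measurable (neg a).
Proof.
by move=> ma; apply: measurable_maxe => //; exact: measurableT_comp.
Qed.

Lemma cube_integralE a : mark_measurable a -> one_signed2 a ->
  cube_integral a = \int[L]_phi cube_sum (pos a) phi - \int[L]_phi cube_sum (neg a) phi.
Proof.
move=> ma sa; rewrite -cube_integral_sub.
- apply: eq_integral => phi _; congr series_over; apply/funext => z.
  have := congr1 (@^~ (z, phi)) (funeposneg (fun p : Z * configs R d K => a p.1 p.2)).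
  by rewrite /= funeposE funenegE.
- by move=> z phi; rewrite le_max lexx orbT.
- by move=> z phi; rewrite le_max lexx orbT.
- exact: mark_measurable_pos.
- exact: mark_measurable_neg.
- have := one_signed_subtractable sa.
  rewrite (_ : _^\+ = fun p => pos a p.1 p.2).
    by rewrite (_ : _^\- = fun p => neg a p.1 p.2)//; apply/funext => p; rewrite funenegE.
  by apply/funext => p; rewrite funeposE.
Qed.

Lemma measurable_cube_series a : mark_measurable a -> measurable_fun setT
  (fun phi : configs R d K =>
     series_over (atoms phi `&` [set z | unit_cube z.1]) (a ^~ phi)).
Proof.
move=> ma; rewrite (_ : (fun phi => _) = fun phi => cube_sum (pos a) phi - cube_sum (neg a) phi).
  apply: emeasurable_funB; apply: measurable_cube_sum.
  - by move=> z phi; rewrite le_max lexx orbT.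
  - exact: mark_measurable_pos.
  - by move=> z phi; rewrite le_max lexx orbT.
  - exact: mark_measurable_neg.
apply/funext => phi; rewrite /series_over; congr (_ - _); apply: eq_esum => z _.
  by rewrite funeposE.
by rewrite funenegE.
Qed.

Lemma eq_cube_integral_ae a b : mark_measurable a -> mark_measurable b ->
  {ae L, forall phi, forall z, atoms phi z -> unit_cube z.1 -> a z phi = b z phi} ->
  cube_integral a = cube_integral b.
Proof.
move=> ma mb ab; apply: ae_eq_integral => //.
- exact: measurable_cube_series.
- exact: measurable_cube_series.
move: ab; apply: ae_imp => phi ab _; rewrite /series_over.
by congr (_ - _); apply: eq_esum => z [pz cz]; rewrite ?funeposE ?funenegE ab.
Qed.

Lemma pos_ge0 a z phi : 0 <= pos a z phi.
Proof. by rewrite le_max lexx orbT. Qed.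

Lemma neg_ge0 a z phi : 0 <= neg a z phi.
Proof. by rewrite le_max lexx orbT. Qed.

Let le_pos a b : (forall z phi, a z phi <= b z phi) -> forall z phi, pos a z phi <= pos b z phi.
Proof. by move=> ab z phi; rewrite ge_max !le_max ab lexx orbT. Qed.

Let le_neg a b : (forall z phi, a z phi <= b z phi) -> forall z phi, neg b z phi <= neg a z phi.
Proof. by move=> ab z phi; rewrite ge_max !le_max leeN2 ab lexx orbT. Qed.

Let le_integral_cube_sum u v : mark_measurable u -> mark_measurable v ->
  (forall z phi, 0 <= u z phi) -> (forall z phi, u z phi <= v z phi) ->
  \int[L]_phi cube_sum u phi <= \int[L]_phi cube_sum v phi.
Proof.
move=> mu mv u0 uv.
have v0 z phi : 0 <= v z phi by exact: le_trans (uv z phi).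
apply: ge0_le_integral => //.
- by move=> phi _; exact: cube_sum_ge0.
- exact: measurable_cube_sum.
- exact: measurable_cube_sum.
- by move=> phi _; apply: le_esum => z _; exact: uv.
Qed.

Lemma le_cube_integral a b : mark_measurable a -> mark_measurable b ->
  one_signed2 a -> one_signed2 b -> (forall z phi, a z phi <= b z phi) ->
  cube_integral a <= cube_integral b.
Proof.
move=> ma mb sa sb ab; rewrite !cube_integralE//; apply: leeB.
  apply: le_integral_cube_sum; [exact: mark_measurable_pos|exact: mark_measurable_pos
    |exact: pos_ge0|exact: le_pos].
apply: le_integral_cube_sum; [exact: mark_measurable_neg|exact: mark_measurable_neg
  |exact: neg_ge0|exact: le_neg].
Qed.

(** The difference of the two sums is nonnegative with zero mean; once the sums agree
and are finite, so do their terms. *)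
Let eq_integral_cube_sum u v : mark_measurable u -> mark_measurable v ->
  (forall z phi, 0 <= u z phi) -> (forall z phi, u z phi <= v z phi) ->
  \int[L]_phi cube_sum u phi = \int[L]_phi cube_sum v phi ->
  \int[L]_phi cube_sum v phi < +oo ->
  {ae L, forall phi, forall z, atoms phi z -> unit_cube z.1 -> u z phi = v z phi}.
Proof.
move=> mu mv u0 uv E voo.
have v0 z phi : 0 <= v z phi by exact: le_trans (uv z phi).
have iv : L.-integrable setT (cube_sum v).
  apply/integrableP; split; first exact: measurable_cube_sum.
  by under eq_integral do rewrite gee0_abs ?cube_sum_ge0//.
have iu : L.-integrable setT (cube_sum u).
  apply/integrableP; split; first exact: measurable_cube_sum.
  by under eq_integral do rewrite gee0_abs ?cube_sum_ge0//; rewrite E.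
have luv phi : cube_sum u phi <= cube_sum v phi by apply: le_esum => z _; exact: uv.
have d0 : \int[L]_phi (cube_sum v phi - cube_sum u phi) = 0.
  by rewrite integralB// E subee// ge0_fin_numE// integral_ge0// => phi _; exact: cube_sum_ge0.
have md : measurable_fun setT (fun phi => cube_sum v phi - cube_sum u phi).
  by apply: emeasurable_funB; exact: measurable_cube_sum.
have fv := integrable_ae measurableT iv.
have fu := integrable_ae measurableT iu.
have m0 : measurable_fun setT (fun phi => maxe (cube_sum v phi - cube_sum u phi) 0).
  exact: measurable_maxe.
have dp : {ae L, forall phi, maxe (cube_sum v phi - cube_sum u phi) 0 = 0}.
  apply/ge0_integral_eq0P => //; first by move=> phi; rewrite le_max lexx orbT.
  rewrite -[RHS]d0; apply: ae_eq_integral => //.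
  move: fv fu; apply: filterS2 => phi fv fu _; rewrite max_l// sube_ge0 ?luv//.
  by rewrite fu.
move: fv fu dp; apply: filterS3 => phi /(_ I) fv /(_ I) fu dp z pz cz.
have vu : cube_sum v phi <= cube_sum u phi.
  by rewrite -sube_le0 -dp le_max lexx.
apply: (@esum_eq_pointwise _ _ (atoms phi `&` [set z | unit_cube z.1]) (u ^~ phi) (v ^~ phi)) => //.
- by apply/eqP; rewrite eq_le luv.
- by rewrite -ge0_fin_numE//; exact: cube_sum_ge0.
Qed.

(** Two ordered families with the same finite expected sum over the cube agree on the
atoms of the cube.  The positive and the negative parts are both ordered, and they
are dealt with separately. *)
Lemma cube_integral_eq_ae a b : mark_measurable a -> mark_measurable b ->
  one_signed2 a -> one_signed2 b -> (forall z phi, a z phi <= b z phi) ->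
  cube_integral a = cube_integral b -> cube_integral b \is a fin_num ->
  {ae L, forall phi, forall z, atoms phi z -> unit_cube z.1 -> a z phi = b z phi}.
Proof.
move=> ma mb sa sb ab; rewrite !cube_integralE//.
have mpa := mark_measurable_pos ma; have mpb := mark_measurable_pos mb.
have mna := mark_measurable_neg ma; have mnb := mark_measurable_neg mb.
have pab := le_integral_cube_sum mpa mpb (@pos_ge0 a) (le_pos ab).
have nab := le_integral_cube_sum mnb mna (@neg_ge0 b) (le_neg ab).
have ipos u : (forall z phi, 0 <= u z phi) -> 0 <= \int[L]_phi cube_sum u phi.
  by move=> u0; apply: integral_ge0 => phi _; exact: cube_sum_ge0.
have := ipos _ (@pos_ge0 a); have := ipos _ (@neg_ge0 b).
move=> nb0 pa0 E bfin.
have [Ep Epoo En Enoo] := sub_fin_eq pa0 nb0 pab nab E bfin.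
have := eq_integral_cube_sum mpa mpb (@pos_ge0 a) (le_pos ab) Ep Epoo.
have := eq_integral_cube_sum mnb mna (@neg_ge0 b) (le_neg ab) En Enoo.
apply: ae_imp2 => phi nE pE z pz cz.
have sum c : c z phi = pos c z phi - neg c z phi.
  have := congr1 (@^~ (z, phi)) (funeposneg (fun p : Z * configs R d K => c p.1 p.2)).
  by rewrite /= funeposE funenegE.
by rewrite (sum a) (sum b) nE// pE.
Qed.

End cube_sums.

(** * The score intensity as an expected gain of the marks *)

Section score.
Context {R : realType} {d : nat} {M M' : ptopologicalType}.
Hypotheses (sM : @second_countable M) (sM' : @second_countable M').
Local Notation Z := ('rV[R]_d * (M * M'))%type.
Variable H : 'rV[R]_d -> M' -> configs R d M -> \bar R.
Hypothesis mH : measurable_fun setT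
  (fun u : borel 'rV[R]_d * borel M' * configs R d M => H u.1.1 u.1.2 u.2).
Hypothesis sH : one_signed (fun u : 'rV[R]_d * M' * configs R d M => H u.1.1 u.1.2 u.2).

Let Hp x m phi := maxe (H x m phi) 0.
Let Hn x m phi := maxe (- H x m phi) 0.

Let Hp0 x m phi : 0 <= Hp x m phi. Proof. by rewrite le_max lexx orbT. Qed.
Let Hn0 x m phi : 0 <= Hn x m phi. Proof. by rewrite le_max lexx orbT. Qed.

Let mHp : measurable_fun setT
  (fun u : borel 'rV[R]_d * borel M' * configs R d M => Hp u.1.1 u.1.2 u.2).
Proof. exact: measurable_maxe. Qed.

Let mHn : measurable_fun setT
  (fun u : borel 'rV[R]_d * borel M' * configs R d M => Hn u.1.1 u.1.2 u.2).
Proof. by apply: measurable_maxe => //; exact: measurableT_comp. Qed.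

Let sepH : subtractable (fun u : 'rV[R]_d * M' * configs R d M => Hp u.1.1 u.1.2 u.2)
  (fun u => Hn u.1.1 u.1.2 u.2).
Proof.
have := one_signed_subtractable sH.
rewrite (_ : _^\+ = fun u => Hp u.1.1 u.1.2 u.2); last by apply/funext => u; rewrite funeposE.
by rewrite (_ : _^\- = fun u => Hn u.1.1 u.1.2 u.2)//; apply/funext => u; rewrite funenegE.
Qed.

Lemma mark_gainE m phi : mark_gain H m phi =
  \esum_(z in atoms phi) Hp (- z.1)%R m phi - \esum_(z in atoms phi) Hn (- z.1)%R m phi.
Proof.
by rewrite /mark_gain /series_over; congr (_ - _); apply: eq_esum => z _;
  rewrite ?funeposE ?funenegE.
Qed.

Let subtractable_gain : subtractable
  (fun p : M' * configs R d M => \esum_(z in atoms p.2) Hp (- z.1)%R p.1 p.2)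
  (fun p : M' * configs R d M => \esum_(z in atoms p.2) Hn (- z.1)%R p.1 p.2).
Proof.
apply: (@subtractable_esum _ _ _ (fun p => atoms p.2)
  (fun p z => Hp (- z.1)%R p.1 p.2) (fun p z => Hn (- z.1)%R p.1 p.2)).
exact: (subtractable_comp (fun q => ((- q.2.1)%R, q.1.1, q.1.2)) sepH).
Qed.

Lemma one_signed_mark_gain :
  one_signed (fun p : M' * configs R d M => mark_gain H p.1 p.2).
Proof.
have := subtractable_one_signed _ _ subtractable_gain.
rewrite (_ : (fun _ => _ - _) = (fun p : M' * configs R d M => mark_gain H p.1 p.2)); last first.
  by apply/funext => p; rewrite mark_gainE.
by apply => p; exact: esum_ge0.
Qed.

Let measurable_esum_gain (h : 'rV[R]_d -> M' -> configs R d M -> \bar R) :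
  measurable_fun setT
    (fun u : borel 'rV[R]_d * borel M' * configs R d M => h u.1.1 u.1.2 u.2) ->
  (forall x m phi, 0 <= h x m phi) ->
  measurable_fun setT (fun p : borel M' * configs R d M =>
    \esum_(z in atoms p.2) h (- z.1)%R p.1 p.2).
Proof.
move=> mh h0.
apply: (@measurable_esum_atoms _ _ _ _ (borel M' * configs R d M)%type snd measurable_snd
  (fun q => h (- q.2.1)%R q.1.1 q.1.2)) => //.
have m2 := @measurable_snd _ _ (borel M' * configs R d M)%type (borel ('rV[R]_d * M)%type).
have m1 := @measurable_fst _ _ (borel M' * configs R d M)%type (borel ('rV[R]_d * M)%type).
have mp : measurable_fun setT (fun q : (borel M' * configs R d M) * borel ('rV[R]_d * M)%type =>
    ((- q.2.1)%R : borel 'rV[R]_d, q.1.1, q.1.2)).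
  apply: measurable_fun_pair; last exact: (measurableT_comp measurable_snd m1).
  apply: measurable_fun_pair; last exact: (measurableT_comp measurable_fst m1).
  under eq_fun do rewrite -sub0r.
  by apply: measurable_subV; [exact: measurable_cst|exact: (measurable_fst_borel m2)].
exact: (measurableT_comp mh mp).
Qed.

Lemma measurable_mark_gain : measurable_fun setT
  (fun p : borel M' * configs R d M => mark_gain H p.1 p.2).
Proof.
under eq_fun do rewrite mark_gainE.
by apply: emeasurable_funB; exact: measurable_esum_gain.
Qed.

Definition atom_gain (z : Z) (psi : configs R d (M * M')%type) : \bar R :=
  mark_gain H z.2.2 (shift z.1 (project psi)).

Definition base_from (f : configs R d M -> \bar R) (z : Z)
  (psi : configs R d (M * M')%type) : \bar R := f (shift z.1 (project psi)).

Let measurable_view dX (X : measurableType dX) (f : X -> configs R d (M * M')%type)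
    (z : X -> Z) : measurable_fun setT f -> @measurable_fun _ _ X (borel Z) setT z ->
  measurable_fun setT (fun x => shift (z x).1 (project (f x))).
Proof.
move=> mf mz; apply: measurable_shift => //; first exact: (measurable_fst_borel mz).
exact: (measurableT_comp (measurable_project sM) mf).
Qed.

Lemma mark_measurable_atom_gain : mark_measurable atom_gain.
Proof.
have m2 := @measurable_snd _ _ (configs R d (M * M')%type) (borel Z).
have m1 := @measurable_fst _ _ (configs R d (M * M')%type) (borel Z).
have mp : measurable_fun setT (fun p : configs R d (M * M')%type * borel Z =>
    ((p.2.2.2 : borel M'), shift p.2.1 (project p.1))).
  apply: measurable_fun_pair; first exact: (measurable_snd_borel (measurable_snd_borel m2)).
  exact: measurable_view.
exact: (measurableT_comp measurable_mark_gain mp).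
Qed.

Lemma mark_measurable_base_from f : measurable_fun setT f -> mark_measurable (base_from f).
Proof.
move=> mf.
have m2 := @measurable_snd _ _ (configs R d (M * M')%type) (borel Z).
have m1 := @measurable_fst _ _ (configs R d (M * M')%type) (borel Z).
have mv : measurable_fun setT (fun p : configs R d (M * M')%type * borel Z =>
    shift p.2.1 (project p.1)) := measurable_view m1 m2.
exact: (measurableT_comp mf mv).
Qed.

Lemma one_signed_atom_gain : one_signed2 atom_gain.
Proof.
case: one_signed_mark_gain => h; [left|right] => p;
  exact: (h (p.1.2.2, shift p.1.1 (project p.2))).
Qed.

Lemma one_signed_base_from f : one_signed f -> one_signed2 (base_from f).
Proof. by case=> h; [left|right] => p; exact: h. Qed.

(** What the mark of [w] contributes to the score of the point [z], for a
nonnegative [h] in place of [H].  It is invariant under shifts of [z], [w] and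
[psi] together, hence a mass that can be transported. *)
Let share (h : 'rV[R]_d -> M' -> configs R d M -> \bar R) (z w : Z)
    (psi : configs R d (M * M')%type) : \bar R :=
  h (w.1 - z.1)%R w.2.2 (shift w.1 (project psi)).

Let share_score h (z : Z) (psi : configs R d (M * M')%type) :=
  \esum_(w in atoms psi) share h z w psi.

Let share_gain h (w : Z) (psi : configs R d (M * M')%type) :=
  \esum_(z in atoms psi) share h z w psi.

Let measurable_share dX (X : measurableType dX) h (f : X -> configs R d (M * M')%type)
    (z w : X -> Z) :
  measurable_fun setT
    (fun u : borel 'rV[R]_d * borel M' * configs R d M => h u.1.1 u.1.2 u.2) ->
  measurable_fun setT f -> @measurable_fun _ _ X (borel Z) setT z ->
  @measurable_fun _ _ X (borel Z) setT w ->
  measurable_fun setT (fun x => share h (z x) (w x) (f x)).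
Proof.
move=> mh mf mz mw.
have mp : measurable_fun setT (fun x => (((w x).1 - (z x).1)%R : borel 'rV[R]_d,
    (w x).2.2 : borel M', shift (w x).1 (project (f x)))).
  apply: measurable_fun_pair; last exact: measurable_view.
  apply: measurable_fun_pair; last exact: (measurable_snd_borel (measurable_snd_borel mw)).
  by apply: measurable_subV; [exact: (measurable_fst_borel mw)|exact: (measurable_fst_borel mz)].
exact: (measurableT_comp mh mp).
Qed.

Let mark_measurable_share_score h :
  measurable_fun setT
    (fun u : borel 'rV[R]_d * borel M' * configs R d M => h u.1.1 u.1.2 u.2) ->
  (forall x m phi, 0 <= h x m phi) -> mark_measurable (share_score h).
Proof.
move=> mh h0.
apply: (@measurable_esum_atoms _ _ _ _ (configs R d (M * M')%type * borel Z)%type fst measurable_fst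
  (fun q => share h q.1.2 q.2 q.1.1)) => //.
  by move=> q; exact: h0.
have m2 := @measurable_snd _ _ (configs R d (M * M')%type * borel Z)%type (borel Z).
have m1 := @measurable_fst _ _ (configs R d (M * M')%type * borel Z)%type (borel Z).
exact: (measurable_share mh (measurableT_comp measurable_fst m1)
  (measurableT_comp measurable_snd m1) m2).
Qed.

Let mark_measurable_share_gain h :
  measurable_fun setT
    (fun u : borel 'rV[R]_d * borel M' * configs R d M => h u.1.1 u.1.2 u.2) ->
  (forall x m phi, 0 <= h x m phi) -> mark_measurable (share_gain h).
Proof.
move=> mh h0.
apply: (@measurable_esum_atoms _ _ _ _ (configs R d (M * M')%type * borel Z)%type fst measurable_fst
  (fun q => share h q.2 q.1.2 q.1.1)) => //.
  by move=> q; exact: h0.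
have m2 := @measurable_snd _ _ (configs R d (M * M')%type * borel Z)%type (borel Z).
have m1 := @measurable_fst _ _ (configs R d (M * M')%type * borel Z)%type (borel Z).
exact: (measurable_share mh (measurableT_comp measurable_fst m1)
  m2 (measurableT_comp measurable_snd m1)).
Qed.

Let share_score_ge0 h : (forall x m phi, 0 <= h x m phi) ->
  forall z psi, 0 <= share_score h z psi.
Proof. by move=> h0 z psi; apply: esum_ge0 => w _; exact: h0. Qed.

Let share_gain_ge0 h : (forall x m phi, 0 <= h x m phi) ->
  forall z psi, 0 <= share_gain h z psi.
Proof. by move=> h0 z psi; apply: esum_ge0 => w _; exact: h0. Qed.

(** A shift by [z.1] followed by a shift by [w.1 - z.1] is the shift by [w.1], so
that the score seen from [z] is a sum over the atoms of the unshifted [psi]. *)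
Let mark_scoreE (z : Z) (psi : configs R d (M * M')%type) : mark_score H (shift z.1 psi) =
  share_score Hp z psi - share_score Hn z psi.
Proof.
rewrite /mark_score /series_over; congr (_ - _).
  under eq_esum do rewrite funeposE.
  rewrite esum_shift; apply: eq_esum => w _ /=.
  by rewrite project_shift shiftD [(z.1 + _)%R]addrC subrK.
under eq_esum do rewrite funenegE.
rewrite esum_shift; apply: eq_esum => w _ /=.
by rewrite project_shift shiftD [(z.1 + _)%R]addrC subrK.
Qed.

Let atom_gainE w psi : atom_gain w psi = share_gain Hp w psi - share_gain Hn w psi.
Proof.
rewrite /atom_gain mark_gainE; congr (_ - _).
  by rewrite esum_shift esum_project; apply: eq_esum => z _; rewrite /share /= opprB.
by rewrite esum_shift esum_project; apply: eq_esum => z _; rewrite /share /= opprB.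
Qed.

Let subtractable_share_score : subtractable
  (fun p : Z * configs R d (M * M')%type => share_score Hp p.1 p.2)
  (fun p => share_score Hn p.1 p.2).
Proof.
apply: (@subtractable_esum _ _ _ (fun p => atoms p.2)
  (fun p w => share Hp p.1 w p.2) (fun p w => share Hn p.1 w p.2)).
exact: (subtractable_comp (fun q : (Z * configs R d (M * M')%type) * Z =>
  ((q.2.1 - q.1.1.1)%R, q.2.2.2, shift q.2.1 (project q.1.2))) sepH).
Qed.

Let subtractable_share_gain : subtractable
  (fun p : Z * configs R d (M * M')%type => share_gain Hp p.1 p.2)
  (fun p => share_gain Hn p.1 p.2).
Proof.
apply: (@subtractable_esum _ _ _ (fun p => atoms p.2)
  (fun p z => share Hp z p.1 p.2) (fun p z => share Hn z p.1 p.2)).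
exact: (subtractable_comp (fun q : (Z * configs R d (M * M')%type) * Z =>
  ((q.1.1.1 - q.2.1)%R, q.1.1.2.2, shift q.1.1.1 (project q.1.2))) sepH).
Qed.

Lemma score_intensityE (Q : probability (configs R d (M * M')%type) R) :
  score_intensity (mark_score H) Q =
  cube_integral Q (fun z psi => mark_score H (shift z.1 psi)).
Proof. by []. Qed.

Lemma mark_measurable_score : mark_measurable (fun z psi => mark_score H (shift z.1 psi)).
Proof.
rewrite /mark_measurable; under eq_fun do rewrite mark_scoreE.
by apply: emeasurable_funB; exact: mark_measurable_share_score.
Qed.

(** The points of the cube collect the contributions of all marks; by mass transport
this has the same mean as what all points collect from the marks in the cube. *)
Theorem score_intensity_gain (Q : probability (configs R d (M * M')%type) R) :
  stationary Q -> intensity Q < +oo ->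
  score_intensity (mark_score H) Q = cube_integral Q atom_gain.
Proof.
move=> sQ iQ; rewrite score_intensityE.
have transport h : measurable_fun setT
    (fun u : borel 'rV[R]_d * borel M' * configs R d M => h u.1.1 u.1.2 u.2) ->
    (forall x m phi, 0 <= h x m phi) ->
    \int[Q]_psi cube_sum (share_score h) psi = \int[Q]_psi cube_sum (share_gain h) psi.
  move=> mh h0.
  have cube_cell u : (forall z psi, 0 <= u z psi) -> mark_measurable u ->
      \int[Q]_psi cube_sum u psi =
      \int[Q]_psi (\esum_(z in atoms psi `&` [set z | cell z.1 = 0%R]) u z psi).
    move=> u0 mu; apply: ge0_ae_eq_integral => //.
    - exact: measurable_cube_sum.
    - apply: (@measurable_esum_atoms_in _ _ _ _ _ id [set p | cell p.2.1 = 0%R]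
        (fun p => u p.2 p.1)) => //.
      rewrite -[X in measurable X]setTI.
      have m2 := @measurable_snd _ _ (configs R d (M * M')%type) (borel Z).
      exact: (measurable_fst_borel m2 measurableT (measurable_cell 0%R)).
    - by move=> psi _; exact: cube_sum_ge0.
    - by move=> psi _; exact: esum_ge0.
    - have := ae_unit_cube_cell (second_countable_prod sM sM') sQ iQ.
      by apply: ae_imp => psi E _; rewrite /cube_sum E.
  rewrite !cube_cell.
  - apply: (@mass_transport _ _ _ (second_countable_prod sM sM') Q sQ (share h)).
    + by move=> *; exact: h0.
    + have m1 := @measurable_fst _ _ (configs R d (M * M')%type * borel Z)%type (borel Z).
      have m2 := @measurable_snd _ _ (configs R d (M * M')%type * borel Z)%type (borel Z).
      exact: (measurable_share mh (measurableT_comp measurable_fst m1)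
        (measurableT_comp measurable_snd m1) m2).
    + move=> y z w psi; rewrite /share /= project_shift shiftD [(y + _)%R]addrC subrK.
      by rewrite opprB addrA subrK.
  - exact: share_gain_ge0.
  - exact: mark_measurable_share_gain.
  - exact: share_score_ge0.
  - exact: mark_measurable_share_score.
have -> : (fun z psi => mark_score H (shift z.1 psi)) =
    (fun z psi => share_score Hp z psi - share_score Hn z psi).
  by apply/funext => z; apply/funext => psi; rewrite mark_scoreE.
have -> : atom_gain = (fun z psi => share_gain Hp z psi - share_gain Hn z psi).
  by apply/funext => z; apply/funext => psi; rewrite atom_gainE.
rewrite !cube_integral_sub.
- by rewrite !transport.
- exact: share_gain_ge0.
- exact: share_gain_ge0.
- exact: mark_measurable_share_gain.
- exact: mark_measurable_share_gain.
- exact: subtractable_share_gain.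
- exact: share_score_ge0.
- exact: share_score_ge0.
- exact: mark_measurable_share_score.
- exact: mark_measurable_share_score.
- exact: subtractable_share_score.
Qed.

End score.

(** * Measurable selection of maximisers on the half-line *)

Section halfline_argmax.
Context {R : realType}.
Local Notation M' := (halfline R).

Fact to_half_subproof (x : R) : Num.max x 0%R \in [set x : R | (0 <= x)%R].
Proof. by rewrite inE /= le_max lexx orbT. Qed.

Definition to_half (x : R) : M' := exist _ (Num.max x 0%R) (to_half_subproof x).

Lemma val_to_half x : val (to_half x) = Num.max x 0%R. Proof. by []. Qed.

Lemma val_halfline_ge0 (m : M') : (0 <= val m)%R.
Proof. by have := valP m; rewrite inE. Qed.

Lemma to_halfK (m : M') : to_half (val m) = m.
Proof. by apply: val_inj; rewrite val_to_half max_l// val_halfline_ge0. Qed.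

Lemma continuous_to_half : continuous to_half.
Proof.
apply/continuousP => _ [V oV <-].
have /continuousP := (fun x : R => @continuous_max R R (fun y => y) (fun=> 0%R) x
  (fun _ h => h) (@cst_continuous _ _ _ x)).
by apply.
Qed.

(** Over an interval with rational left end the supremum over the rationals is that
of the continuous function, but as a countable supremum it is measurable in a
random parameter. *)
Definition rat_sup (r t : R) (g : M' -> \bar R) : \bar R :=
  ereal_sup [set g (to_half (ratr q)) | q in [set q : rat | (r <= ratr q <= t)%R]].

Variable g : M' -> \bar R.
Hypothesis cg : continuous g.

Let cgh : continuous (g \o to_half).
Proof. by move=> x; apply: continuous_comp; [exact: continuous_to_half|exact: cg]. Qed.

(** A value of [g] is approached through rationals on the left of [m].  No rational of
the interval lies on the left of its left end, which is why the latter is itself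
rational. *)
Lemma le_rat_sup (q0 : rat) (t : R) (m : M') :
  (ratr q0 <= val m <= t)%R -> g m <= rat_sup (ratr q0) t g.
Proof.
move=> /andP[rm mt]; rewrite leNgt; apply/negP => lt.
have [E|rt] := eqVneq (ratr q0) (val m).
  move: lt; apply/negP; rewrite -leNgt; apply: ereal_sup_ubound.
  by exists q0; rewrite /= ?E ?lexx// to_halfK.
have {}rt : (ratr q0 < val m)%R by rewrite lt_neqAle rt.
have : nbhs (val m) ((g \o to_half) @^-1` [set y | rat_sup (ratr q0) t g < y]).
  apply: open_nbhs_nbhs; split; last by rewrite /= to_halfK.
  by move/continuousP : cgh; apply; exact: open_ereal_gt_ereal.
move=> /nbhs_ballP[e /= e0 eV].
(* A rational slightly below [m] at which the value of [g] is still too large. *)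
have /rat_in_itvoo[q] : (Num.max (ratr q0) (val m - e) < val m)%R.
  by rewrite gt_max rt /= ltrBlDr ltrDl.
rewrite in_itv /= gt_max => /andP[/andP[rq meq] qm].
have : rat_sup (ratr q0) t g < g (to_half (ratr q)).
  apply: (eV (ratr q)); rewrite /ball /= ltr_distlC.
  by apply/andP; split; [exact: meq|apply: (lt_trans qm); rewrite ltrDl].
apply/negP; rewrite -leNgt; apply: ereal_sup_ubound; exists q => //=.
by rewrite (ltW rq)/= (le_trans (ltW qm)).
Qed.

Lemma ereal_dense (x y : \bar R) : x < y -> exists r : R, x < r%:E < y.
Proof.
case: x y => [x||] [y||]//; rewrite ?lte_fin => xy.
- by exists ((x + y) / 2)%R; rewrite !lte_fin; apply/andP; split; lra.
- by exists (x + 1)%R; rewrite ltry lte_fin ltrDl ltr01.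
- by exists (y - 1)%R; rewrite ltNyr lte_fin ltrBlDr ltrDl ltr01.
- by exists 0%R; rewrite ltNyr ltry.
Qed.

(** If [g < F] on the compact interval, cover it by the open sets [g < i] with [i < F]
real; a finite subcover bounds the supremum by some [i < F]. *)
Lemma rat_sup_attained (r t : R) (F : \bar R) : (0 <= r <= t)%R ->
  (forall m, g m <= F) -> F <= rat_sup r t g ->
  exists m : M', (r <= val m <= t)%R /\ g m = F.
Proof.
move=> /andP[r0 rt] gF Fs; apply: contrapT => nex.
have lt x : (r <= x <= t)%R -> g (to_half x) < F.
  move=> xrt; rewrite lt_neqAle gF andbT; apply/eqP => gx; apply: nex.
  exists (to_half x); split => //; rewrite val_to_half max_l//.
  by case/andP: xrt => rx _; exact: le_trans rx.
have := @segment_compact R r t; rewrite compact_cover.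
move=> /(_ R [set i : R | i%:E < F] (fun i => (g \o to_half) @^-1` [set y | y < i%:E])).
case.
- by move=> i _; move/continuousP : cgh; apply; exact: open_ereal_lt_ereal.
- move=> x /=; rewrite in_itv /= => /lt /ereal_dense[i /andP[gi iF]].
  by exists i.
move=> D DF cD.
have maxF : \big[maxe/-oo]_(i <- D) i%:E < F.
  rewrite big_seq; apply: bigmax_lt => [|i /DF]; last by rewrite inE.
  by apply: le_lt_trans (lt r _); rewrite ?leNye// lexx.
move: Fs; apply/negP; rewrite -ltNge; apply: le_lt_trans maxF.
apply: ge_ereal_sup => _ [q /= qrt <-].
have [|i /= iD gi] := cD (ratr q); first by rewrite /= in_itv.
by apply: (le_trans (ltW gi)); exact: le_bigmax_seq.
Qed.

Definition argmax_from (r : R) (m : M') := is_argmax g m /\ (r <= val m)%R.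

Definition least_from (r : R) (m : M') :=
  argmax_from r m /\ forall m', argmax_from r m' -> (val m <= val m')%R.

Lemma least_from_uniq r m m' : least_from r m -> least_from r m' -> m = m'.
Proof.
move=> [am lm] [am' lm']; apply: val_inj; apply/eqP.
by rewrite eq_le lm// lm'.
Qed.

(** The maximisers between [r] and [val m] form a nonempty compact set. *)
Lemma ex_least_from r m : (0 <= r)%R -> argmax_from r m -> exists m0, least_from r m0.
Proof.
move=> r0 [am rm].
pose A := `[r, val m]%classic `&` (g \o to_half) @^-1` [set y | g m <= y].
have cA : compact A.
  apply: compact_closedI; first exact: segment_compact.
  by move/continuous_closedP : cgh; apply; exact: closed_ereal_le_ereal.
have A0 : A !=set0.
  by exists (val m); split; rewrite /= ?in_itv /= ?rm ?lexx//= to_halfK.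
have cid : {within A, continuous (fun x : R => x)}.
  by apply: continuous_subspaceT => x; exact: cvg_id.
have [c] := compact_EVT_min A0 cA cid.
rewrite inE => -[]; rewrite /= in_itv/= => /andP[rc cm] gc cmin.
have vc : val (to_half c) = c by rewrite val_to_half max_l// (le_trans r0).
exists (to_half c); split; first split; rewrite ?vc// => m'.
  exact: le_trans (am m') gc.
move=> [am' rm']; have [m'm|/ltW mm'] := leP (val m') (val m); last exact: le_trans mm'.
by apply: cmin; rewrite inE; split; rewrite /= ?in_itv /= ?rm' ?m'm// to_halfK; exact: am'.
Qed.

Definition select_argmax (r : R) : M' := xget (to_half 0) (least_from r).

Lemma select_argmaxP r m : (0 <= r)%R -> argmax_from r m -> least_from r (select_argmax r).
Proof.
move=> r0 /(ex_least_from r0)[m0 lm0]; rewrite /select_argmax.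
by case: xgetP => // /(_ m0).
Qed.

Lemma select_argmax_none r : ~ (exists m, argmax_from r m) -> select_argmax r = to_half 0.
Proof.
move=> nex; rewrite /select_argmax; case: xgetP => // m _ [am _].
by exfalso; apply: nex; exists m.
Qed.

Definition total_sup : \bar R := ereal_sup [set g (to_half (ratr q)) | q in [set: rat]].

Lemma le_total_sup m : g m <= total_sup.
Proof.
apply: (@le_trans _ _ (rat_sup (ratr 0%Q) (val m) g)).
  by apply: le_rat_sup; rewrite rmorph0 val_halfline_ge0 lexx.
by apply: le_ereal_sup => _ [q _ <-]; exists q.
Qed.

Lemma is_argmaxP m : is_argmax g m <-> g m = total_sup.
Proof.
split=> [am|E m']; last by rewrite E; exact: le_total_sup.
apply/eqP; rewrite eq_le le_total_sup/=.
by apply: ge_ereal_sup => _ [q _ <-]; exact: am.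
Qed.

(** Membership of a maximiser in a segment is expressed by two countable suprema,
which makes it a measurable event when [g] is random. *)
Lemma argmax_segmentP (q0 : rat) (t : R) : ((0 : R) <= ratr q0 <= t)%R ->
  total_sup <= rat_sup (ratr q0) t g <->
  exists m : M', argmax_from (ratr q0) m /\ (val m <= t)%R.
Proof.
move=> q0t; split=> [le|[m [[am rm] mt]]].
  have [m [/andP[rm mt] gm]] := rat_sup_attained q0t le_total_sup le.
  by exists m; split => //; split => //; exact/is_argmaxP.
by move/is_argmaxP : am => <-; apply: le_rat_sup; rewrite rm.
Qed.

End halfline_argmax.

Section measurable_argmax.
Context {R : realType}.
Local Notation M' := (halfline R).
Variables (dX : measure_display) (X : measurableType dX).
Variable f : M' -> X -> \bar R.
Hypothesis mf : forall m, measurable_fun setT (f m).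
Hypothesis cf : forall x, continuous (f ^~ x).

Let measurable_sup_rat (S : set rat) : measurable_fun setT
  (fun x => ereal_sup [set f (to_half (ratr q)) x | q in S]).
Proof.
pose u n x := if pickle_inv n is Some q then
  (if q \in S then f (to_half (ratr q)) x else -oo) else -oo : \bar R.
have mu n : measurable_fun setT (u n).
  rewrite /u; case: (pickle_inv n) => [q|]; last exact: measurable_cst.
  by case: (q \in S) => //; exact: measurable_cst.
rewrite (_ : (fun x => _) = fun x => esups (u ^~ x) 0%N); first exact: measurable_fun_esups.
apply/funext => x; apply/eqP; rewrite eq_le; apply/andP; split; apply: ge_ereal_sup.
  move=> _ [q Sq <-]; apply: ereal_sup_ubound; exists (choice.pickle q) => //.
  by rewrite /u pickleK_inv mem_set.
move=> _ [n _ <-]; rewrite /u; case: pickle_inv => [q|]; rewrite ?leNye//.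
case: ifPn => [|_]; rewrite ?leNye// inE => Sq.
by apply: ereal_sup_ubound; exists q.
Qed.

Lemma measurable_total_sup : measurable_fun setT (fun x => total_sup (f ^~ x)).
Proof. exact: (measurable_sup_rat setT). Qed.

Let segment_event (r t : R) := [set x | total_sup (f ^~ x) <= rat_sup r t (f ^~ x)].

Let measurable_segment_event r t : measurable (segment_event r t).
Proof.
rewrite -[X in measurable X]setTI; apply: measurable_lee => //.
  exact: measurable_total_sup.
exact: measurable_sup_rat.
Qed.

Variable q0 : rat.
Hypothesis q0_ge0 : (0 <= q0)%R.
Let r : R := ratr q0.
Let r0 : (0 <= r)%R. Proof. by rewrite ler0q. Qed.

Lemma measurable_ex_argmax_from :
  measurable [set x | exists m, argmax_from (f ^~ x) r m].
Proof.
rewrite (_ : [set x | _] = \bigcup_n segment_event r (r + n%:R)).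
  by apply: bigcup_measurable => n _; exact: measurable_segment_event.
have rn n : (0 <= r <= r + n%:R)%R by rewrite r0 lerDl ler0n.
apply/seteqP; split=> [x [m am]|x [n _ /(@argmax_segmentP _ (f ^~ x) (@cf x) _ _ (rn n))[m [am _]]]].
  exists (Num.truncn (val m)).+1 => //; apply/(@argmax_segmentP _ (f ^~ x) (@cf x) _ _ (rn _)).
  exists m; split => //; apply: (le_trans (ltW (Num.Theory.truncnS_gt _))).
  by rewrite lerDr.
by exists m.
Qed.

(** The selected maximiser is at most [t] exactly when some maximiser lies in
the segment from [r] to [t], which is a measurable event; without a maximiser the
selection is constant. *)
Let select_le t : [set x | (val (select_argmax (f ^~ x) r) <= t)%R] =
  ([set x | exists m, argmax_from (f ^~ x) r m] `&`
    (if (r <= t)%R then segment_event r t else set0)) `|`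
  (~` [set x | exists m, argmax_from (f ^~ x) r m] `&`
    (if (0 <= t)%R then setT else set0)).
Proof.
apply/seteqP; split=> x /=.
  have [ex|nex] := pselect (exists m, argmax_from (f ^~ x) r m).
    move=> st; left; split => //; have [m am] := ex.
    have [[as_ rs] ls] := @select_argmaxP _ (f ^~ x) (@cf x) _ _ r0 am.
    have rt := le_trans rs st; rewrite rt.
    apply/(@argmax_segmentP _ (f ^~ x) (@cf x)) => //; first by rewrite r0.
    by exists (select_argmax (f ^~ x) r); split.
  by rewrite select_argmax_none// val_to_half maxxx => t0; right; rewrite t0.
move=> [[[m am]]|[nex]].
  have lm := @select_argmaxP _ (f ^~ x) (@cf x) _ _ r0 am.
  case: ifPn => // rt /(@argmax_segmentP _ (f ^~ x) (@cf x) _ _ _)[|m' [am' m't]]; first by rewrite r0.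
  by apply: le_trans m't; exact: lm.2.
by rewrite select_argmax_none// val_to_half maxxx; case: ifP.
Qed.

Lemma measurable_select_argmax :
  @measurable_fun _ _ X (borel M') setT (fun x => select_argmax (f ^~ x) r).
Proof.
have mv : @measurable_fun _ _ X R setT (fun x => val (select_argmax (f ^~ x) r)).
  apply: (measurability _ (RGenOInfty.measurableE R)) => _ [_ [t ->] <-].
  rewrite setTI (_ : _ @^-1` _ = ~` [set x | (val (select_argmax (f ^~ x) r) <= t)%R]).
    apply: measurableC; rewrite select_le; apply: measurableU; apply: measurableI.
    - exact: measurable_ex_argmax_from.
    - by case: ifP => // _; exact: measurable_segment_event.
    - by apply: measurableC; exact: measurable_ex_argmax_from.
    - by case: ifP.
  apply/seteqP; split=> x /=; first by rewrite in_itv /= andbT ltNge => /negP.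
  by move/negP; rewrite -ltNge in_itv /= andbT.
apply: measurable_fun_borel => _ [V oV <-].
rewrite -[X in measurable X]setTI; exact: (mv measurableT _ (open_measurable oV)).
Qed.

End measurable_argmax.

(** * Uniqueness of the optimal marking for an everywhere continuous gain *)

Section avoid.
Context {R : realType} {d : nat} {K : ptopologicalType}.
Hypothesis sK : @second_countable K.
Local Notation Z := ('rV[R]_d * K)%type.

(** The event says that the number of atoms in the section of [A] is 0. *)
Lemma measurable_avoid (A : set (configs R d K * borel Z)) : measurable A ->
  measurable [set phi : configs R d K | forall z, atoms phi z -> ~ A (phi, z)].
Proof.
move=> mA; pose u (p : configs R d K * borel Z) : \bar R := (\1_A p)%:E.
pose e (phi : configs R d K) : \bar R := \esum_(z in atoms phi) u (phi, z).
have u0 p : 0 <= u p by rewrite lee_fin.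
have me : measurable_fun setT e.
  have mi : measurable_fun setT (fun phi : configs R d K => phi) by exact: measurable_id.
  have mu : measurable_fun setT u.
    by apply/measurable_EFinP; exact: measurable_indic.
  exact: (measurable_esum_atoms mi u0 mu).
rewrite (_ : [set phi | _] = setT `&` e @^-1` [set 0]).
  by apply: me => //; exact: emeasurable_set1.
rewrite setTI; apply/seteqP; split=> phi /=.
  by move=> h; apply: esum1 => z pz; rewrite /u indicE memNset//; exact: h.
move/(@esum_eq0P _ _ _ _ (fun z _ => u0 (phi, z))) => h z pz Az.
by have := h z pz; rewrite /u indicE mem_set//= => /eqP; rewrite eqe oner_eq0.
Qed.

Lemma measurable_no_atom (A : set (configs R d K)) : measurable A ->
  measurable [set phi : configs R d K | forall z, atoms phi z -> ~ A (shift z.1 phi)].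
Proof.
move=> mA; apply: (@measurable_avoid [set p | A (shift p.2.1 p.1)]).
have m1 := @measurable_fst _ _ (configs R d K) (borel Z).
have m2 := @measurable_snd _ _ (configs R d K) (borel Z).
rewrite -[X in measurable X]setTI.
exact: (measurable_shift sK (measurable_fst_borel m2) m1).
Qed.

End avoid.

Section marking_laws.
Context {R : realType} {d : nat} {M M' : ptopologicalType}.
Hypotheses (sM : @second_countable M) (sM' : @second_countable M').
Local Notation Z := ('rV[R]_d * (M * M'))%type.
Variable L : probability (configs R d M) R.

Section given_marking.
Variables (Q : probability (configs R d (M * M')%type) R) (QL : is_marking L Q).

Lemma ae_project (P : configs R d M -> Prop) :
  {ae L, forall phi, P phi} -> {ae Q, forall psi, P (project psi)}.
Proof.
move=> [N [mN LN NP]]; exists (@project R d M M' @^-1` N); split.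
- by rewrite -[X in measurable X]setTI; exact: measurable_project.
- by rewrite QL.2.
- by move=> psi /= nP; exact: NP.
Qed.

(** [E] has to be measurable here, as a null set of marked configurations need not
project to a null set. *)
Lemma ae_of_project (E : set (configs R d M)) : measurable E ->
  {ae Q, forall psi, E (project psi)} -> {ae L, forall phi, E phi}.
Proof.
move=> mE [N [mN QN NE]]; exists (~` E); split => //.
  exact: measurableC.
have mE' : measurable (@project R d M M' @^-1` ~` E).
  rewrite -[X in measurable X]setTI; apply: (measurable_project sM) => //.
  exact: measurableC.
have := QL.2 (~` E) (measurableC mE) => <-.
by apply: (subset_measure0 _ mN _ QN) => // psi; exact: NE.
Qed.

Lemma integral_project (g : configs R d M -> \bar R) : measurable_fun setT g ->
  \int[Q]_psi g (project psi) = \int[L]_phi g phi.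
Proof.
have ge0 (h : configs R d M -> \bar R) : measurable_fun setT h -> (forall phi, 0 <= h phi) ->
    \int[Q]_psi h (project psi) = \int[L]_phi h phi.
  move=> mh h0.
  have := @ge0_integral_pushforward _ _ _ _ R _ (measurable_project sM) Q setT h measurableT mh.
  rewrite preimage_setT => <-; last by move=> phi _.
  apply: (eq_measure_integral L) => [|mp A mA _]; first exact: measurable_project.
  by rewrite /= /pushforward QL.2.
move=> mg; rewrite integralE [RHS]integralE; congr (_ - _).
  by rewrite -ge0//; [apply: eq_integral => psi _; rewrite !funeposE|exact: measurable_funepos].
by rewrite -ge0//; [apply: eq_integral => psi _; rewrite !funenegE|exact: measurable_funeneg].
Qed.

Lemma intensity_marking : intensity Q = intensity L.
Proof.
rewrite /intensity; rewrite -integral_project.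
  apply: eq_integral => psi _; rewrite !evaluation_esum esum_project.
  apply: eq_esum => z _; rewrite !indicE.
  suff -> : (z \in @unit_cube R d `*` [set: M * M']) =
    ((z.1, z.2.1) \in @unit_cube R d `*` [set: M]) by [].
  by apply/idP/idP; rewrite !inE => -[].
have mf := measurable_fst_borel (@measurable_id _ (borel ('rV[R]_d * M)%type) setT).
apply: measurable_evaluation.
rewrite (_ : _ `*` _ = (fst : borel ('rV[R]_d * M)%type -> borel 'rV[R]_d) @^-1` (@unit_cube R d)).
  by rewrite -[X in measurable X]setTI; apply: mf => //; exact: measurable_unit_cube.
by apply/seteqP; split=> [z []|z].
Qed.

Lemma cube_integral_base_from (f : configs R d M -> \bar R) : measurable_fun setT f ->
  cube_integral Q (base_from f) = cube_integral L (fun z phi => f (shift z.1 phi)).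
Proof.
move=> mf; rewrite /cube_integral -[RHS]integral_project.
  apply: eq_integral => psi _; rewrite /series_over !esum_mkcondr !esum_project.
  have E (z : Z) : (z \in [set z : Z | unit_cube z.1]) =
      ((z.1, z.2.1) \in [set z : 'rV[R]_d * M | unit_cube z.1]).
    by apply/idP/idP; rewrite !inE.
  by congr (_ - _); apply: eq_esum => z _; rewrite -E ?funeposE ?funenegE.
apply: measurable_cube_series.
have m2 := @measurable_snd _ _ (configs R d M) (borel ('rV[R]_d * M)%type).
have mv : measurable_fun setT (fun p : configs R d M * borel ('rV[R]_d * M)%type =>
    shift p.2.1 p.1).
  by apply: measurable_shift => //; exact: (measurable_fst_borel m2).
exact: (measurableT_comp mf mv).
Qed.

End given_marking.

Section mark_law.
Variable m : configs R d M -> M'.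
Hypothesis mm : @measurable_fun _ _ (configs R d M) (borel M') setT m.
Hypothesis sL : stationary L.

Let measurable_mark := measurable_mark_by sM sM' mm.

Let mark_mfun : {mfun configs R d M >-> configs R d (M * M')%type} :=
  HB.pack (mark_by m) (isMeasurableFun.Build _ _ _ _ _ measurable_mark).

Definition mark_law : probability (configs R d (M * M')%type) R := distribution L mark_mfun.

Lemma mark_lawE A : mark_law A = L (mark_by m @^-1` A).
Proof. by []. Qed.

Lemma mark_law_marking : is_marking L mark_law.
Proof.
split=> [y A mA|A mA]; rewrite !mark_lawE.
  have mA' : measurable (mark_by m @^-1` A).
    by rewrite -[X in measurable X]setTI; exact: measurable_mark.
  rewrite -(sL y mA'); congr (L _).
  by apply/seteqP; split=> phi /=; rewrite mark_by_shift.
by congr (L _); apply/seteqP; split=> phi /=; rewrite project_mark_by.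
Qed.

Lemma ae_mark_law (P : configs R d (M * M')%type -> Prop) :
  {ae mark_law, forall psi, P psi} -> {ae L, forall phi, P (mark_by m phi)}.
Proof.
move=> [N [mN LN NP]]; exists (mark_by m @^-1` N); split => //.
- by rewrite -[X in measurable X]setTI; exact: measurable_mark.
- by move=> phi /= nP; exact: NP.
Qed.

End mark_law.
End marking_laws.

Section core.
Context {R : realType} {d : nat} {M : ptopologicalType}.
Hypothesis (sM : @second_countable M).
Local Notation M' := (halfline R).
Let sM' := second_countable_halfline R.
Local Notation Z := ('rV[R]_d * (M * M'))%type.

Lemma measurable_val_halfline : @measurable_fun _ _ (borel M') R setT val.
Proof.
apply: (measurability _ (RGenOpens.measurableE R)) => _ [_ [x [y ->]] <-].
rewrite setTI; apply: borel_open; by exists `]x, y[%classic.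
Qed.

Variables (H : 'rV[R]_d -> M' -> configs R d M -> \bar R).
Hypothesis mH : measurable_fun setT
  (fun u : borel 'rV[R]_d * borel M' * configs R d M => H u.1.1 u.1.2 u.2).
Hypothesis sH : one_signed (fun u : 'rV[R]_d * M' * configs R d M => H u.1.1 u.1.2 u.2).
Hypothesis cH : forall phi, continuous (fun m => mark_gain H m phi).

Variable L : probability (configs R d M) R.
Hypotheses (sL : stationary L) (iL : intensity L < +oo).

Let f (m : M') (phi : configs R d M) := mark_gain H m phi.
Let F phi := total_sup (f ^~ phi).

Let mf m : measurable_fun setT (f m).
Proof.
have mp : measurable_fun setT (fun phi : configs R d M => ((m : borel M'), phi)).
  by apply: measurable_fun_pair => //; exact: measurable_cst.
exact: (measurableT_comp (measurable_mark_gain mH) mp).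
Qed.

Let mF : measurable_fun setT F.
Proof. exact: measurable_total_sup. Qed.

Let fF m phi : f m phi <= F phi.
Proof. exact: (@le_total_sup _ (f ^~ phi) (@cH phi)). Qed.

Let argmaxP m phi : is_argmax (f ^~ phi) m <-> f m phi = F phi.
Proof. exact: (@is_argmaxP _ (f ^~ phi) (@cH phi)). Qed.

(** In the first case of [one_signed], [F] is either [-oo] or at least a nonnegative
value of [f]. *)
Let sF : one_signed F.
Proof.
have [h|h] := one_signed_mark_gain sH; [left|right] => phi.
  have [[m fm]|nm] := pselect (exists m, 0 <= f m phi).
    by right; exact: le_trans (fF m phi).
  left; apply/eqP; rewrite -leeNy_eq; apply: ge_ereal_sup => _ [q _ <-].
  have /= [h0|h0] := h (to_half (ratr q), phi); first by rewrite /f h0.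
  by exfalso; apply: nm; exists (to_half (ratr q)).
by apply: ge_ereal_sup => _ [q _ <-]; exact: (h (to_half (ratr q), phi)).
Qed.

(** The upper bound for the intensities of all markings. *)
Let V := cube_integral L (fun z phi => F (shift z.1 phi)).

Let mgain : mark_measurable (atom_gain H : Z -> configs R d (M * M')%type -> \bar R).
Proof. exact: mark_measurable_atom_gain. Qed.
Let mbase : mark_measurable (base_from F : Z -> configs R d (M * M')%type -> \bar R).
Proof. exact: mark_measurable_base_from. Qed.

Let score_gain (Q : probability (configs R d (M * M')%type) R) : is_marking L Q ->
  score_intensity (mark_score H) Q = cube_integral Q (atom_gain H).
Proof.
move=> QL; apply: score_intensity_gain => //; first exact: QL.1.
by rewrite (intensity_marking sM QL).
Qed.

Let score_le (Q : probability (configs R d (M * M')%type) R) : is_marking L Q ->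
  score_intensity (mark_score H) Q <= V.
Proof.
move=> QL; rewrite score_gain// /V -(cube_integral_base_from sM QL mF).
apply: le_cube_integral => //.
- exact: one_signed_atom_gain.
- exact: one_signed_base_from.
- by move=> z psi; exact: fF.
Qed.

Let score_max (Q : probability (configs R d (M * M')%type) R) : is_marking L Q ->
  {ae Q, forall psi, forall z, atoms psi z -> is_argmax (f ^~ (shift z.1 (project psi))) z.2.2} ->
  score_intensity (mark_score H) Q = V.
Proof.
move=> QL h; rewrite score_gain// /V -(cube_integral_base_from sM QL mF).
apply: eq_cube_integral_ae => //.
by apply: ae_imp h => psi h z pz _; apply/argmaxP; exact: h.
Qed.

Let max_optimal (Q : probability (configs R d (M * M')%type) R) : is_marking L Q ->
  {ae Q, forall psi, forall z, atoms psi z -> is_argmax (f ^~ (shift z.1 (project psi))) z.2.2} ->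
  intensity_optimal (mark_score H) L Q /\ optimal_intensity (mark_score H) L = V.
Proof.
move=> QL h; have E : optimal_intensity (mark_score H) L = V.
  apply/eqP; rewrite eq_le; apply/andP; split.
    by apply: ge_ereal_sup => _ [Q' QL' <-]; exact: score_le.
  by rewrite -(score_max QL h); apply: ereal_sup_ubound; exists Q.
by split => //; split => //; rewrite E score_max.
Qed.

Let select (q : rat) phi := select_argmax (f ^~ phi) (ratr q : R).

Let mselect q : (0 <= q)%R ->
  @measurable_fun _ _ (configs R d M) (borel M') setT (select q).
Proof. by move=> q0; exact: (measurable_select_argmax mf cH). Qed.

Let selectP q phi m : (0 <= q)%R -> argmax_from (f ^~ phi) (ratr q) m ->
  least_from (f ^~ phi) (ratr q) (select q phi).
Proof. by move=> q0; apply: (@select_argmaxP _ (f ^~ phi) (@cH phi)); rewrite ler0q. Qed.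

Let argmax_from0 phi m : is_argmax (f ^~ phi) m -> argmax_from (f ^~ phi) (ratr 0%Q) m.
Proof. by move=> am; split => //; rewrite rmorph0 val_halfline_ge0. Qed.

Let select0_least phi m : is_argmax (f ^~ phi) m -> least_argmax (f ^~ phi) (select 0 phi).
Proof.
move=> /argmax_from0 /(selectP (lexx _))[[am _] lm]; split => // m' am'.
by apply: lm; exact: argmax_from0.
Qed.

(** The marks of [mark_by m phi] follow the rule [m] by construction; what is to be
checked is that the set of such marked configurations is measurable, so that its
complement is a null set of the law. *)
Let ae_mark_law_mark m (mm : @measurable_fun _ _ (configs R d M) (borel M') setT m) :
  {ae mark_law sM sM' L mm, forall psi, forall z, atoms psi z ->
     z.2.2 = m (shift z.1 (project psi))}.
Proof.
pose A : set (configs R d (M * M')%type * borel Z) :=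
  [set p | val p.2.2.2 != val (m (shift p.2.1 (project p.1)))].
have m1 := @measurable_fst _ _ (configs R d (M * M')%type) (borel Z).
have m2 := @measurable_snd _ _ (configs R d (M * M')%type) (borel Z).
have mA : measurable A.
  have mv : measurable_fun setT (fun p : configs R d (M * M')%type * borel Z =>
      shift p.2.1 (project p.1)).
    apply: (measurable_shift sM); first exact: (measurable_fst_borel m2).
    exact: (measurableT_comp (measurable_project sM) m1).
  have e1 := measurableT_comp measurable_val_halfline
    (measurable_snd_borel (measurable_snd_borel m2)).
  have e2 := measurableT_comp measurable_val_halfline (measurableT_comp mm mv).
  have := measurable_fun_eqr e1 e2 => /(_ measurableT [set false] I).
  rewrite setTI; congr measurable; apply/seteqP; split=> p /=.
    by move/negbT.
  by move/negbTE.
exists (~` [set psi : configs R d (M * M')%type | forall z, atoms psi z -> ~ A (psi, z)]).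
split.
- by apply: measurableC; exact: measurable_avoid.
- rewrite mark_lawE (_ : _ @^-1` _ = set0) ?measure0//.
  apply/seteqP; split=> phi //= ne; apply: ne => _ [z pz <-].
  by rewrite /A /= project_mark_by eqxx.
- move=> psi nh h; apply: nh => z pz; have /negP := h z pz.
  by rewrite negbK => /eqP /val_inj.
Qed.

Let argmax_law_optimal m (mm : @measurable_fun _ _ (configs R d M) (borel M') setT m) :
  {ae L, forall phi, forall z, atoms phi z ->
     is_argmax (f ^~ (shift z.1 phi)) (m (shift z.1 phi))} ->
  intensity_optimal (mark_score H) L (mark_law sM sM' L mm) /\
  optimal_intensity (mark_score H) L = V.
Proof.
move=> h; have QL := mark_law_marking sM sM' mm sL; apply: max_optimal => //.
have := ae_mark_law_mark mm; have := ae_project sM QL h.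
apply: ae_imp2 => psi h1 h2 z pz; rewrite h2//.
have := h1 (z.1, z.2.1); apply; by exists z.
Qed.

(** [A] is the exceptional set of configurations, which are almost surely seen from no
point.  The finiteness of the optimal intensity is what turns equality of
expectations into almost sure equality of [f] and [F] at the marks. *)
Theorem unique_argmax_unique_optimal (A : set (configs R d M)) :
  -oo < optimal_intensity (mark_score H) L < +oo -> measurable A ->
  {ae L, forall phi, forall z, atoms phi z -> ~ A (shift z.1 phi)} ->
  (forall phi, ~ A phi -> exists! m, is_argmax (f ^~ phi) m) ->
  exists Q : probability (configs R d (M * M')%type) R,
     [/\ argmax_marking H Q, intensity_optimal (mark_score H) L Q
       & forall Q' : probability (configs R d (M * M')%type) R,
           intensity_optimal (mark_score H) L Q' ->
           forall B, measurable B -> Q' B = Q B].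
Proof.
move=> opt mA LA hA.
have m0 := mselect (lexx 0%R).
have sel phi m : ~ A phi -> is_argmax (f ^~ phi) m -> m = select 0 phi.
  move=> /hA[m' [am' um']] am; rewrite -(um' m am); apply: um'.
  exact: (select0_least am).1.
have LA' : {ae L, forall phi, forall z, atoms phi z ->
     least_argmax (f ^~ (shift z.1 phi)) (select 0 (shift z.1 phi))}.
  apply: ae_imp LA => phi h z pz; have [m [am _]] := hA _ (h z pz).
  exact: select0_least am.
have QL := mark_law_marking sM sM' m0 sL.
have [Qopt optV] : intensity_optimal (mark_score H) L (mark_law sM sM' L m0) /\
    optimal_intensity (mark_score H) L = V.
  by apply: argmax_law_optimal; apply: ae_imp LA' => phi h z pz; exact: (h z pz).1.
exists (mark_law sM sM' L m0); split => //.
  have := ae_mark_law_mark m0; have := ae_project sM QL LA'.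
  apply: ae_imp2 => psi h1 h2 z pz; rewrite h2//.
  by have := h1 (z.1, z.2.1); apply; exists z.
move=> Q' [QL' Q'V] B mB.
have Vfin : V \is a fin_num.
  by rewrite -optV fin_numElt.
have gainE : {ae Q', forall psi, forall z, atoms psi z -> unit_cube z.1 ->
    atom_gain H z psi = base_from F z psi}.
  apply: cube_integral_eq_ae => //.
  - exact: one_signed_atom_gain.
  - exact: one_signed_base_from.
  - by move=> z psi; exact: fF.
  - by rewrite (cube_integral_base_from sM QL' mF) -score_gain// Q'V optV.
  - by rewrite (cube_integral_base_from sM QL' mF).
have markE : {ae Q', forall psi, mark_by (select 0) (project psi) = psi}.
  (* From the points of the cube to all points, by stationarity. *)
  have all : {ae Q', forall psi, forall z, atoms psi z ->
      f z.2.2 (project (shift z.1 psi)) = F (project (shift z.1 psi))}.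
    apply: (@ae_unit_cube_atoms _ _ _ (second_countable_prod sM sM') Q' QL'.1
      (fun k psi => f k.2 (project psi) = F (project psi))).
    by apply: ae_imp gainE => psi h z pz cz; rewrite !project_shift; exact: h.
  have := ae_project sM QL' LA; have := all.
  apply: ae_imp2 => psi h1 h2; apply: mark_by_projectP => z pz.
  apply: sel; first by apply: (h2 (z.1, z.2.1)); exists z.
  by apply/argmaxP; have := h1 z pz; rewrite project_shift.
have mT : measurable (mark_by (select 0) @^-1` B).
  by rewrite -[X in measurable X]setTI; exact: (measurable_mark_by sM sM' m0).
have mT' : measurable (@project R d M M' @^-1` (mark_by (select 0) @^-1` B)).
  by rewrite -[X in measurable X]setTI; exact: (measurable_project sM).
rewrite mark_lawE -QL'.2//.
rewrite -[B in LHS]setIT -[X in _ = Q' X]setIT -!integral_indic//.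
apply: ae_eq_integral => //.
- by apply/measurable_EFinP; exact: measurable_indic.
- by apply/measurable_EFinP; exact: measurable_indic.
by apply: ae_imp markE => psi E _; rewrite !indicE; congr (_%:R%:E);
  congr nat_of_bool; apply/idP/idP; rewrite !inE /= E.
Qed.

(** The exceptional set consists of the configurations without a maximiser, and of
those for which, for some rational [q], some maximiser is at least [q] but the
overall least one is not the least of these. *)
Theorem unique_optimal_unique_argmax
  (Q : probability (configs R d (M * M')%type) R) :
  argmax_marking H Q -> intensity_optimal (mark_score H) L Q ->
  (forall Q' : probability (configs R d (M * M')%type) R,
     intensity_optimal (mark_score H) L Q' -> forall B, measurable B -> Q' B = Q B) ->
  exists2 A, measurable A &
    {ae L, forall phi, forall z, atoms phi z -> ~ A (shift z.1 phi)} /\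
    (forall phi, ~ A phi -> exists! m, is_argmax (f ^~ phi) m).
Proof.
move=> Qarg [QL Qopt] Quniq.
pose Ex (q : rat) := [set phi | exists m, argmax_from (f ^~ phi) (ratr q : R) m].
have mEx q : (0 <= q)%R -> measurable (Ex q).
  by move=> q0; exact: (measurable_ex_argmax_from mf cH).
have LEx : {ae L, forall phi, forall z, atoms phi z -> Ex 0%R (shift z.1 phi)}.
  have : {ae L, forall phi, forall z, atoms phi z -> ~ (~` Ex 0%R) (shift z.1 phi)}.
    apply: (ae_of_project sM QL).
      by apply: (measurable_no_atom sM); apply: measurableC; exact: mEx.
    apply: ae_imp Qarg => psi h _ [z pz <-] /=; apply => /=.
    by exists z.2.2; apply: argmax_from0; exact: (h z pz).1.
  by apply: ae_imp => phi h z pz; apply: contrapT => nE; exact: (h z pz).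
pose bad (q : rat) := Ex q `&` [set phi | val (select q phi) != val (select 0 phi)].
have mbad q : (0 <= q)%R -> measurable (bad q).
  move=> q0; apply: measurableI; first exact: mEx.
  have e1 := measurableT_comp measurable_val_halfline (mselect q0).
  have e2 := measurableT_comp measurable_val_halfline (mselect (lexx 0%R)).
  have := measurable_fun_eqr e1 e2 => /(_ measurableT [set false] I).
  rewrite setTI; congr measurable; apply/seteqP; split=> p /=.
    by move/negbT.
  by move/negbTE.
have Lbad q : (0 <= q)%R ->
    {ae L, forall phi, forall z, atoms phi z -> ~ bad q (shift z.1 phi)}.
  (* The rule [m_q]: it coincides with the least maximiser unless a maximiser is at
     least [q], and it is a maximiser in any case. *)
  move=> q0; pose m phi := if phi \in Ex q then select q phi else select 0 phi.
  have mm : @measurable_fun _ _ (configs R d M) (borel M') setT m.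
    move=> _ B mB; rewrite setTI.
    rewrite (_ : _ @^-1` _ = (Ex q `&` (select q @^-1` B)) `|`
        (~` Ex q `&` (select 0 @^-1` B))).
      apply: measurableU; apply: measurableI.
      - exact: mEx.
      - by rewrite -[X in measurable X]setTI; exact: (mselect q0).
      - by apply: measurableC; exact: mEx.
      - by rewrite -[X in measurable X]setTI; exact: (mselect (lexx 0%R)).
    apply/seteqP; split=> phi /=; rewrite /m.
      by case: ifPn => [/set_mem|/negP]; [left|rewrite inE; right].
    by move=> [[E]|[nE]]; [rewrite mem_set|rewrite memNset].
  have marg : {ae L, forall phi, forall z, atoms phi z ->
      is_argmax (f ^~ (shift z.1 phi)) (m (shift z.1 phi))}.
    apply: ae_imp LEx => phi h z pz; rewrite /m; case: ifPn => [/set_mem[m' am']|_].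
      exact: (selectP q0 am').1.1.
    by have [m' [am' _]] := h z pz; exact: (select0_least am').1.
  have [mopt _] := argmax_law_optimal mm marg.
  (* By uniqueness the law of this marking is [Q], whose marks are least maximisers. *)
  have marg2 : argmax_marking H (mark_law sM sM' L mm).
    have [N [mN QN NP]] := Qarg; exists N; split => //.
    by rewrite -QN; exact: Quniq.
  have := ae_mark_law marg2; apply: ae_imp => phi h z pz [Eq /eqP ne].
  have := h (z.1, (z.2, m (shift z.1 phi))).
  rewrite /= project_mark_by => /(_ _)[|am lm]; first by exists z.
  apply: ne; congr val; move: am lm; rewrite /m mem_set// => am lm.
  apply: (@least_from_uniq _ (f ^~ (shift z.1 phi)) (ratr 0%Q)).
    by split; [exact: argmax_from0|move=> m' [am' _]; exact: lm].
  exact: (selectP (lexx _) (argmax_from0 am)).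
pose A := ~` Ex 0%R `|` \bigcup_(q in [set q : rat | (0 <= q)%R]) bad q.
exists A; last split.
- apply: measurableU; first by apply: measurableC; exact: mEx.
  by apply: countable_bigcup_measurable => // q; exact: mbad.
- have : {ae L, forall phi, forall q : rat, (0 <= q)%R ->
      forall z, atoms phi z -> ~ bad q (shift z.1 phi)}.
    apply: ae_countable => q; have [q0|q0] := boolP (0 <= q)%R; last exact: aeW.
    by apply: ae_imp (Lbad q q0) => phi h _.
  move: LEx; apply: ae_imp2 => phi h1 h2 z pz [nE|[q q0 bq]].
    by apply: nE; exact: h1.
  exact: (h2 q q0 z pz).
move=> phi nA.
have [m am] : Ex 0%R phi by apply: contrapT => nE; apply: nA; left.
have [as0 ls0] := select0_least am.1.
exists (select 0 phi); split => // m' am'; apply: val_inj; apply/eqP.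
rewrite eq_le ls0//= leNgt; apply/negP => lt; apply: nA; right.
(* A second maximiser [m'] lies beyond some rational [q] to the right of the
   least one, so [m_q] is not the least one. *)
have [q] := rat_in_itvoo lt; rewrite in_itv/= => /andP[sq qm'].
have q0 : (0 <= q)%R.
  by rewrite -(ler0q R) ltW// (le_lt_trans (val_halfline_ge0 _) sq).
have aq : argmax_from (f ^~ phi) (ratr q) m' by split => //; exact: ltW.
exists q => //; split; first by exists m'.
have [[_ rs] _] := selectP q0 aq.
by rewrite /= gt_eqF// (lt_le_trans sq).
Qed.

End core.

(** * Reduction to an everywhere continuous gain *)

Lemma eq_series_over {R : realType} (T : choiceType) (S : set T) (a b : T -> \bar R) :
  (forall z, S z -> a z = b z) -> series_over S a = series_over S b.
Proof.
move=> ab; rewrite /series_over; congr (_ - _); apply: eq_esum => z Sz.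
  by rewrite !funeposE ab.
by rewrite !funenegE ab.
Qed.

Lemma series_over0 {R : realType} (T : choiceType) (S : set T) (a : T -> \bar R) :
  (forall z, S z -> a z = 0) -> series_over S a = 0.
Proof.
move=> a0; rewrite /series_over !esum1 ?sube0// => z Sz.
  by rewrite funenegE a0// oppe0 maxxx.
by rewrite funeposE a0// maxxx.
Qed.

Section agreement.
Context {R : realType} {d : nat} {M M' : ptopologicalType}.
Hypothesis sM : @second_countable M.
Variables (H1 H2 : 'rV[R]_d -> M' -> configs R d M -> \bar R).
Variable (W : set (configs R d M)).
Hypothesis H12 : forall x m phi, W phi -> H1 x m phi = H2 x m phi.

Lemma eq_mark_gain m phi : W phi -> mark_gain H1 m phi = mark_gain H2 m phi.
Proof. by move=> Wphi; apply: eq_series_over => z _; exact: H12. Qed.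

Lemma eq_mark_score (psi : configs R d (M * M')%type) :
  (forall z, atoms psi z -> W (shift z.1 (project psi))) ->
  mark_score H1 psi = mark_score H2 psi.
Proof. by move=> Wpsi; apply: eq_series_over => z pz; exact/H12/Wpsi. Qed.

Variable L : probability (configs R d M) R.
Hypothesis LW : {ae L, forall phi, forall z, atoms phi z -> W (shift z.1 phi)}.

Lemma ae_marking_atoms (Q : probability (configs R d (M * M')%type) R) : is_marking L Q ->
  {ae Q, forall psi, forall z, atoms psi z -> W (shift z.1 (project psi))}.
Proof.
move=> QL; have := ae_project sM QL LW; apply: ae_imp => psi h z pz.
by apply: (h (z.1, z.2.1)); exists z.
Qed.

(** Both scores at a point only involve the base process seen from points, that is,
almost surely configurations of [W]. *)
Lemma eq_score_intensity (Q : probability (configs R d (M * M')%type) R) :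
  measurable_fun setT
    (fun u : borel 'rV[R]_d * borel M' * configs R d M => H1 u.1.1 u.1.2 u.2) ->
  measurable_fun setT
    (fun u : borel 'rV[R]_d * borel M' * configs R d M => H2 u.1.1 u.1.2 u.2) ->
  is_marking L Q ->
  score_intensity (mark_score H1) Q = score_intensity (mark_score H2) Q.
Proof.
move=> m1 m2 QL; apply: eq_cube_integral_ae.
- exact: (mark_measurable_score sM m1).
- exact: (mark_measurable_score sM m2).
have := ae_marking_atoms QL; apply: ae_imp => psi h z pz _.
apply: eq_mark_score => _ [w pw <-] /=.
by rewrite project_shift shiftD [(z.1 + _)%R]addrC subrK; exact: h.
Qed.

End agreement.

Lemma eq_intensity_optimal {R : realType} {d : nat} {M M' : topologicalType}
    (xi1 xi2 : configs R d (M * M')%type -> \bar R) (L : probability (configs R d M) R) :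
  (forall Q, is_marking L Q -> score_intensity xi1 Q = score_intensity xi2 Q) ->
  optimal_intensity xi1 L = optimal_intensity xi2 L /\
  forall Q, intensity_optimal xi1 L Q <-> intensity_optimal xi2 L Q.
Proof.
move=> E; have O : optimal_intensity xi1 L = optimal_intensity xi2 L.
  rewrite /optimal_intensity; congr ereal_sup; apply/seteqP; split=> _ [Q QL <-].
    by exists Q => //; rewrite E.
  by exists Q => //; rewrite E.
split; first exact: O.
move=> Q; split=> -[QL QO]; (split; first exact: QL).
  by rewrite -(E Q QL) QO; exact: O.
by rewrite (E Q QL) O; exact: QO.
Qed.

Lemma eq_argmax_marking {R : realType} {d : nat} {M : topologicalType}
    (H1 H2 : 'rV[R]_d -> halfline R -> configs R d M -> \bar R)
    (Q : probability (configs R d (M * halfline R)%type) R) :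
  {ae Q, forall psi, forall z, atoms psi z -> forall m,
    mark_gain H1 m (shift z.1 (project psi)) = mark_gain H2 m (shift z.1 (project psi))} ->
  argmax_marking H1 Q -> argmax_marking H2 Q.
Proof.
move=> E h; move: E h; apply: ae_imp2 => psi E h z pz.
have -> : (fun m => mark_gain H2 m (shift z.1 (project psi))) =
    (fun m => mark_gain H1 m (shift z.1 (project psi))).
  by apply/funext => m; rewrite E.
exact: h.
Qed.

Lemma eq_unique_argmax {R : realType} (g1 g2 : halfline R -> \bar R) : g1 =1 g2 ->
  (exists! m, is_argmax g1 m) -> exists! m, is_argmax g2 m.
Proof. by move/funext => ->. Qed.

Section pointed.
Context {R : realType} {d : nat} {M : ptopologicalType}.
Hypothesis (sM : @second_countable M).
Variables (L : probability (configs R d M) R).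
Hypotheses (sL : stationary L) (iL : 0 < intensity L < +oo).
Variables (H : 'rV[R]_d -> halfline R -> configs R d M -> \bar R).
Hypothesis mH : measurable_fun
   [set u : borel 'rV[R]_d * borel (halfline R) * configs R d M | with_origin u.2]
   (fun u => H u.1.1 u.1.2 u.2).
Hypothesis vH : (forall x m phi, with_origin phi ->
                0 <= H x m phi < +oo \/ H x m phi = -oo) \/
             (forall x m phi, with_origin phi -> H x m phi <= 0).
Hypothesis cH : {ae palm L, forall phi, continuous (fun m => mark_gain H m phi)}.
Hypothesis optH : -oo < optimal_intensity (mark_score H) L < +oo.

(** The value 0 outside [V] makes the gain vanish, hence continuous, there. *)
Let cut (V : set (configs R d M)) x m phi := if phi \in V then H x m phi else 0.

Let measurable_cut V : measurable V -> V `<=` @with_origin R d M ->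
  measurable_fun setT (fun u : borel 'rV[R]_d * borel (halfline R) * configs R d M =>
    cut V u.1.1 u.1.2 u.2).
Proof.
move=> mV VO.
have m2 := @measurable_snd _ _ (borel 'rV[R]_d * borel (halfline R))%type (configs R d M).
have mU : measurable [set u : borel 'rV[R]_d * borel (halfline R) * configs R d M | V u.2].
  by rewrite -[X in measurable X]setTI; exact: m2.
apply: measurable_fun_if => //.
- apply: (measurable_fun_bool true); rewrite setTI.
  by move: mU; congr measurable; apply/seteqP; split=> u /=; [move/mem_set|move/set_mem].
- apply: measurable_funS mH => //.
  + rewrite -[X in measurable X]setTI; apply: m2 => //; exact: measurable_with_origin.
  + by move=> u /= [_ /set_mem]; exact: VO.
Qed.

Let cutE V x m phi : V phi -> cut V x m phi = H x m phi.
Proof. by move=> Vphi; rewrite /cut mem_set. Qed.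

Let one_signed_cut V : V `<=` @with_origin R d M ->
  one_signed (fun u : 'rV[R]_d * halfline R * configs R d M => cut V u.1.1 u.1.2 u.2).
Proof.
move=> VO; case: vH => h; [left|right] => u; rewrite /cut; case: ifPn => //.
- by move=> /set_mem /VO /(h u.1.1 u.1.2)[/andP[]|]; [right|left].
- by right.
- by move=> /set_mem /VO /h.
Qed.

Let score_cut_origin :
  mark_score H = mark_score (cut (@with_origin R d M)) :> (configs R d (M * halfline R)%type -> \bar R).
Proof.
apply/funext => psi.
apply: (@eq_mark_score _ _ _ _ _ _ (@with_origin R d M)).
  by move=> x m phi Vphi; rewrite cutE.
by move=> z pz; apply: (@with_origin_shift _ _ _ _ (z.1, z.2.1)); exists z.
Qed.

(** Let [W] be the set of configurations with a point at the origin, without a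
measurable exceptional set outside of which the gain is continuous.  Almost surely
all configurations seen from points are in [W], so that replacing [H] by 0 outside
[W] changes neither the intensities of markings nor their maximisers, and it
makes [H] measurable and the gain continuous everywhere. *)
Theorem unique_optimal_iff_pointed :
  (exists Q : probability (configs R d (M * halfline R)%type) R,
     [/\ argmax_marking H Q,
         intensity_optimal (mark_score H) L Q
       & forall Q' : probability (configs R d (M * halfline R)%type) R,
           intensity_optimal (mark_score H) L Q' ->
           forall A, measurable A -> Q' A = Q A])
  <->
  {ae palm L, forall phi, exists! m, is_argmax (fun m' => mark_gain H m' phi) m}.
Proof.
have [A0 mA0 [LA0 cA0]] := (palm_aeP sM sL _ iL).1 cH.
pose W : set (configs R d M) := @with_origin R d M `&` ~` A0.
have mO := @measurable_with_origin R d M.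
have mW : measurable W by apply: measurableI => //; exact: measurableC.
have LW : {ae L, forall phi, forall z, atoms phi z -> W (shift z.1 phi)}.
  apply: ae_imp LA0 => phi h z pz; split; last exact: h.
  exact: with_origin_shift pz.
have [H' [mH' sH' HW H'0]] : exists H' : 'rV[R]_d -> halfline R -> configs R d M -> \bar R,
    [/\ measurable_fun setT (fun u : borel 'rV[R]_d * borel (halfline R) * configs R d M =>
           H' u.1.1 u.1.2 u.2),
        one_signed (fun u : 'rV[R]_d * halfline R * configs R d M => H' u.1.1 u.1.2 u.2),
        forall x m phi, W phi -> H' x m phi = H x m phi
      & forall x m phi, ~ W phi -> H' x m phi = 0].
  exists (cut W); split.
  - exact: (measurable_cut mW (@subIsetl _ _ _)).
  - exact: one_signed_cut (@subIsetl _ _ _).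
  - by move=> x m phi; exact: cutE.
  - by move=> x m phi nW; rewrite /cut memNset.
have gainW m phi (Wphi : W phi) : mark_gain H' m phi = mark_gain H m phi.
  exact: (eq_mark_gain HW).
have cH' phi : continuous (fun m => mark_gain H' m phi).
  have [Wphi|nW] := pselect (W phi).
    rewrite (_ : (fun m => _) = (fun m => mark_gain H m phi)).
      exact: cA0 Wphi.2.
    by apply/funext => m; exact: gainW.
  rewrite (_ : (fun m => _) = (fun=> 0)); first exact: cst_continuous.
  by apply/funext => m; apply: series_over0 => z _; exact: H'0.
have E Q : is_marking L Q ->
    score_intensity (mark_score H) Q = score_intensity (mark_score H') Q.
  move=> QL; rewrite score_cut_origin.
  have HW' x m phi : W phi -> cut (@with_origin R d M) x m phi = H' x m phi.
    by move=> Wphi; rewrite HW// cutE//; exact: Wphi.1.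
  exact: (eq_score_intensity sM HW' LW (measurable_cut mO (@subset_refl _ _)) mH' QL).
have [optE optQ] := eq_intensity_optimal E.
have [i0 ioo] := andP iL.
have argQ Q : is_marking L Q -> argmax_marking H Q <-> argmax_marking H' Q.
  move=> QL; have h := ae_marking_atoms sM LW QL.
  have gE : {ae Q, forall psi, forall z, atoms psi z -> forall m,
      mark_gain H m (shift z.1 (project psi)) = mark_gain H' m (shift z.1 (project psi))}.
    by apply: ae_imp h => psi hW z pz m; exact: (esym (gainW m _ (hW z pz))).
  have gE' : {ae Q, forall psi, forall z, atoms psi z -> forall m,
      mark_gain H' m (shift z.1 (project psi)) = mark_gain H m (shift z.1 (project psi))}.
    by apply: ae_imp h => psi hW z pz m; exact: (gainW m _ (hW z pz)).
  split; first exact: eq_argmax_marking gE.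
  exact: eq_argmax_marking gE'.
have nAW (A : set (configs R d M)) phi : ~ (A `|` ~` W) phi -> ~ A phi /\ W phi.
  move=> nA; split; first by move=> Aphi; apply: nA; left.
  by apply: contrapT => nW; apply: nA; right.
have LAW (A : set (configs R d M)) :
    {ae L, forall phi, forall z, atoms phi z -> ~ A (shift z.1 phi)} ->
    {ae L, forall phi, forall z, atoms phi z -> ~ (A `|` ~` W) (shift z.1 phi)}.
  move=> LA; move: LA LW; apply: ae_imp2 => phi h1 h2 z pz [|]; first exact: h1.
  by apply; exact: h2.
rewrite (palm_aeP sM sL _ iL); split=> [[Q [argH optH1 uniqH]]|[A mA [LA hA]]].
  have uniqH' Q' : intensity_optimal (mark_score H') L Q' ->
      forall B, measurable B -> Q' B = Q B.
    by move=> /(optQ Q').2; exact: uniqH.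
  have [A mA [LA hA]] := unique_optimal_unique_argmax sM mH' sH' cH' sL ioo
    ((argQ Q optH1.1).1 argH) ((optQ Q).1 optH1) uniqH'.
  exists (A `|` ~` W); first exact: measurableU _ _ mA (measurableC mW).
  split; first exact: LAW.
  move=> phi /nAW[nA Wphi]; apply: eq_unique_argmax (hA phi nA) => m.
  exact: gainW.
have opt' : -oo < optimal_intensity (mark_score H') L < +oo.
  by move: optH; rewrite optE; exact.
have mAW : measurable (A `|` ~` W) := measurableU _ _ mA (measurableC mW).
have hAW phi : ~ (A `|` ~` W) phi -> exists! m, is_argmax (fun m' => mark_gain H' m' phi) m.
  move=> /nAW[nA Wphi]; apply: eq_unique_argmax (hA phi nA) => m.
  exact: (esym (gainW m phi Wphi)).
have [Q [argH' optH' uniqH']] :=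
  unique_argmax_unique_optimal sM mH' sH' cH' sL ioo opt' mAW (LAW A LA) hAW.
exists Q; split.
- exact: (argQ Q optH'.1).2 argH'.
- exact: (optQ Q).2 optH'.
- by move=> Q' /(optQ Q').1; exact: uniqH'.
Qed.

End pointed.

(** Measurable spaces are pointed, so that the Borel sets of [M] form one only once a
point of [M] is chosen. *)
Lemma pointed_space (M : topologicalType) (x : M) :
  exists Mp : ptopologicalType, (Mp : topologicalType) = M.
Proof.
case: M x => T cT x.
by exists (HB.pack_for ptopologicalType T cT (isPointed.Build T x)).
Qed.

(** Without marks there are no points at all. *)
Lemma intensity_gt0_inhabited {R : realType} {d : nat} {M : topologicalType}
  (L : probability (configs R d M) R) : 0 < intensity L -> inhabited M.
Proof.
move=> iL; apply: contrapT => nM; move: iL.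
rewrite /intensity (_ : (fun phi => _) = cst 0) ?integral0 ?ltxx//.
apply/funext => phi; rewrite /evaluation (_ : _ `&` _ = set0).
  by rewrite counting_esum esum_set0.
by apply/seteqP; split=> // -[x k]; case: nM.
Qed.

Unset Implicit Arguments.

Theorem proposition2p6 (R : realType) (d : nat) (hd : (0 < d)%N)
    (M : topologicalType) (M_lc : locally_compact [set: M])
    (M_sc : @second_countable M) (M_T2 : hausdorff_space M)
    (dO : measure_display) (Omega : measurableType dO) (P : probability Omega R)
    (Phi : {mfun Omega >-> configs R d M})
    (Phi_stat : stationary (distribution P Phi))
    (Phi_int : 0 < intensity (distribution P Phi) < +oo)
    (H : 'rV[R]_d -> halfline R -> configs R d M -> \bar R)
    (H_meas : measurable_fun
       [set u : borel 'rV[R]_d * borel (halfline R) * configs R d M |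
          with_origin u.2]
       (fun u => H u.1.1 u.1.2 u.2))
    (H_val : (forall x m phi, with_origin phi ->
                0 <= H x m phi < +oo \/ H x m phi = -oo) \/
             (forall x m phi, with_origin phi -> H x m phi <= 0))
    (f_cont : {ae palm (distribution P Phi), forall phi,
                continuous (fun m => mark_gain H m phi)})
    (opt_fin : -oo < optimal_intensity (mark_score H) (distribution P Phi) < +oo) :
  (exists Q : probability (configs R d (M * halfline R)%type) R,
     [/\ argmax_marking H Q,
         intensity_optimal (mark_score H) (distribution P Phi) Q
       & forall Q' : probability (configs R d (M * halfline R)%type) R,
           intensity_optimal (mark_score H) (distribution P Phi) Q' ->
           forall A, measurable A -> Q' A = Q A])
  <->
  {ae palm (distribution P Phi), forall phi,
     exists! m, is_argmax (fun m' => mark_gain H m' phi) m}.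
Proof.
(* Replace [M] by a pointed copy of itself. *)
have [x] := intensity_gt0_inhabited (andP Phi_int).1.
have [Mp MpM] := pointed_space x.
move: MpM x M_lc M_sc M_T2 Phi Phi_stat Phi_int H H_meas H_val f_cont opt_fin => <- _ _ M_sc _.
move=> Phi Phi_stat Phi_int H H_meas H_val f_cont opt_fin.
exact: unique_optimal_iff_pointed.
Qed.
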